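(* In the setting and under the regularity assumption of the context, the primal DRO problem $\inf_{x\in\mathcal X}\sup_{\mathbb Q\in\mathcal P}\mathbb E_{z\sim\mathbb Q}[\ell(x,z)]$ and the dual DRO problem $\sup_{\mathbb Q\in\mathcal P}\inf_{x\in\mathcal X}\mathbb E_{z\sim\mathbb Q}[\ell(x,z)]$ have finite optimal values and admit a saddle point (a pair $(x^\star,\mathbb Q^\star)\in\mathcal X\times\mathcal P$ with $\mathbb E_{\mathbb Q}[\ell(x^\star,z)]\le\mathbb E_{\mathbb Q^\star}[\ell(x^\star,z)]\le\mathbb E_{\mathbb Q^\star}[\ell(x,z)]$ for all $x\in\mathcal X$, $\mathbb Q\in\mathcal P$). In particular, $$\min_{x\in\mathcal X}\max_{\mathbb Q\in\mathcal P}\mathbb E_{z\sim\mathbb Q}[\ell(x,z)]=\max_{\mathbb Q\in\mathcal P}\min_{x\in\mathcal X}\mathbb E_{z\sim\mathbb Q}[\ell(x,z)].$$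
   Context: Notation: $[n]=\{1,\dots,n\}$; $\mathcal P(\mathcal Z)$ is the set of Borel probability measures on $\mathcal Z$. Setting. $\mathcal X\subseteq\mathbb R^n$, $\mathcal Z\subseteq\mathbb R^m$. A transportation cost $c:\mathcal Z\times\mathcal Z\to\mathbb R_+$ is lower semicontinuous, satisfies $c(z,z)=0$ for all $z$, and $c(\cdot,\hat z)$ is convex for every fixed $\hat z\in\mathcal Z$. The optimal transport discrepancy is $\mathrm{OT}_c(\mathbb P,\mathbb Q)=\min_{\gamma}\mathbb E_{(z,\hat z)\sim\gamma}[c(z,\hat z)]$ over couplings $\gamma$ of $\mathbb P$ and $\mathbb Q$. Given $\hat z_1,\dots,\hat z_N\in\mathcal Z$, let $\hat{\mathbb P}=\frac1N\sum_{i=1}^N\delta_{\hat z_i}$; given $\rho>0$, let $\mathcal P=\{\mathbb P\in\mathcal P(\mathcal Z):\mathrm{OT}_c(\mathbb P,\hat{\mathbb P})\le\rho\}$. Regularity assumption. (i) $\mathcal X$ is nonempty and convex; there exist $\mathbb Q_0\in\mathcal P$ and $x_0\in\mathcal X$ such that $x\mapsto\mathbb E_{z\sim\mathbb Q_0}[\ell(x,z)]$ is inf-compact on $\mathcal X$ (all sublevel sets $\{x\in\mathcal X:\mathbb E_{\mathbb Q_0}[\ell(x,z)]\le a\}$, $a\in\mathbb R$, are compact) and $\mathbb E_{z\sim\mathbb Q_0}[\ell(x_0,z)]>-\infty$; $\mathcal Z$ is nonempty, closed and convex. (ii) $\ell(x,z)=\max_{k\in[K]}\ell_k(x,z)$ with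 $K\ge2$, where each $\ell_k:\mathbb R^n\times\mathbb R^m\to\mathbb R$ is real-valued, convex in its first and concave in its second argument. (iii) There exist a norm $\|\cdot\|$ on $\mathbb R^m$ and $p\ge1$ with $c(z,\hat z)\ge\|z-\hat z\|^p$ for all $z,\hat z\in\mathcal Z$; moreover, if $p=1$, then for every $x\in\mathcal X$ there exist $g>0$, $\hat z_0\in\mathcal Z$ and $r\in[0,1)$ such that $\ell(x,z)\le g[1+\|z-\hat z_0\|^r]$ for all $z\in\mathcal Z$. *)

(* Defs.v *)
From HB Require Import structures.
From mathcomp Require Export all_boot all_order all_algebra.
From mathcomp Require Export all_classical all_reals all_analysis.

Export Order.TTheory GRing.Theory Num.Theory.
Export numFieldNormedType.Exports.

Set Implicit Arguments.
Unset Strict Implicit.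
Unset Printing Implicit Defensive.

Local Open Scope classical_set_scope.
Local Open Scope ring_scope.
Local Open Scope ereal_scope.

(* R^m with its Borel sigma-algebra. *)
Notation borelRV R m := (g_sigma_algebraType (@open 'rV[R]_m)).

(* The norm is nonnegative as a consequence of these axioms; they are those of
   the factory Lmodule_isNormed. *)
Definition is_norm (R : realType) (m : nat) (nrm : 'rV[R]_m -> R) : Prop :=
  [/\ forall z w, (nrm (z + w) <= nrm z + nrm w)%R,
      forall (a : R) z, nrm (a *: z) = (`|a| * nrm z)%R
    & forall z, nrm z = 0%R -> z = 0%R].

Definition concave_function (R : realType) (m : nat) (D : set 'rV[R]_m)
  (f : 'rV[R]_m -> R) : Prop := convex_function D (\- f)%R.

(* A cost on Z x Z is a function on R^m x R^m whose values outside Z x Z are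
   irrelevant; semicontinuity is relative to the subspace topology of Z x Z. *)
Definition transport_cost (R : realType) (m : nat) (Z : set 'rV[R]_m)
    (c : 'rV[R]_m -> 'rV[R]_m -> R) : Prop :=
  [/\ forall z zh, Z z -> Z zh -> (0 <= c z zh)%R,
      @lower_semicontinuous (subspace (Z `*` Z)) R (fun w => (c w.1 w.2)%:E),
      forall z, Z z -> c z z = 0%R
    & forall zh, Z zh -> convex_function Z (c ^~ zh)].

Definition coupling (d : measure_display) (T : measurableType d) (R : realType)
    (g : probability (T * T)%type R) (P Q : probability T R) : Prop :=
  forall A : set T, measurable A ->
    g (fst @^-1` A) = P A /\ g (snd @^-1` A) = Q A.

(* P and Q are meant to be carried by Z; every coupling of them is then carried
   by Z x Z. *)
Definition OT (R : realType) (m : nat) (Z : set 'rV[R]_m)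
    (c : 'rV[R]_m -> 'rV[R]_m -> R) (P Q : probability (borelRV R m) R) :
    \bar R :=
  ereal_inf [set \int[g]_(w in Z `*` Z) (c w.1 w.2)%:E
            | g in [set g : probability (borelRV R m * borelRV R m)%type R
                   | coupling g P Q]].

Section empirical.
Context (R : realType) (m N : nat) (zhat : 'I_N.+1 -> 'rV[R]_m).

Definition empirical (A : set (borelRV R m)) : \bar R :=
  (N.+1%:R^-1)%R%:E * \sum_(i < N.+1) \d_(zhat i : borelRV R m) A.

Let mu : {measure set (borelRV R m) -> \bar R} :=
  mscale ((N.+1%:R^-1)%:nng)%R
    (msum (fun i => \d_(zhat (inord i) : borelRV R m)) N.+1).

Let empiricalE A : empirical A = mu A.
Proof.
rewrite /empirical /mu /= /mscale /= /msum; congr (_ * _).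
by apply: eq_bigr => i _; rewrite inord_val.
Qed.

Let empirical0 : empirical set0 = 0.
Proof. by rewrite empiricalE measure0. Qed.

Let empirical_ge0 A : 0 <= empirical A.
Proof. by rewrite empiricalE. Qed.

Let empirical_sigma_additive : semi_sigma_additive empirical.
Proof.
by rewrite (funext empiricalE); exact: measure_semi_sigma_additive.
Qed.

HB.instance Definition _ := isMeasure.Build _ _ _ empirical
  empirical0 empirical_ge0 empirical_sigma_additive.

Let empirical_setT : empirical setT = 1.
Proof.
rewrite /empirical (eq_bigr (fun=> 1%:E)); last first.
  by move=> i _; rewrite diracT.
by rewrite sumEFin -EFinM sumr_const card_ord mulVf// pnatr_eq0.
Qed.

HB.instance Definition _ :=
  Measure_isProbability.Build _ _ _ empirical empirical_setT.

End empirical.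

(* A Borel probability measure on Z is encoded as one on R^m of mass 1 on Z. *)
Definition ambiguity (R : realType) (m N : nat) (Z : set 'rV[R]_m)
    (c : 'rV[R]_m -> 'rV[R]_m -> R) (zhat : 'I_N.+1 -> 'rV[R]_m) (rho : R) :
    set (probability (borelRV R m) R) :=
  [set P : probability (borelRV R m) R
  | P Z = 1 /\ OT Z c P (empirical zhat) <= rho%:E].

Definition max_loss (R : realType) (n m K : nat)
    (l : 'I_K.+1 -> 'rV[R]_n -> 'rV[R]_m -> R)
    (x : 'rV[R]_n) (z : 'rV[R]_m) : R :=
  \big[Num.max/l ord0 x z]_(k < K.+1) l k x z.

Definition expected_loss (R : realType) (n m : nat)
    (loss : 'rV[R]_n -> 'rV[R]_m -> R)
    (x : 'rV[R]_n) (Q : probability (borelRV R m) R) : \bar R :=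
  'E_Q[loss x].

Definition inf_compact_on (R : realType) (n : nat) (X : set 'rV[R]_n)
    (f : 'rV[R]_n -> \bar R) : Prop :=
  forall a : R, compact [set x | X x /\ f x <= a%:E].

(* With p = 1 the loss has to grow sublinearly; 0 `^ 0 = 1 when r = 0. *)
Definition growth_condition (R : realType) (n m : nat) (X : set 'rV[R]_n)
    (Z : set 'rV[R]_m) (c : 'rV[R]_m -> 'rV[R]_m -> R)
    (loss : 'rV[R]_n -> 'rV[R]_m -> R) : Prop :=
  exists (nrm : 'rV[R]_m -> R) (p : R),
    [/\ is_norm nrm, (1 <= p)%R,
        forall z zh, Z z -> Z zh -> (nrm (z - zh) `^ p <= c z zh)%R
      & p = 1%R -> forall x, X x -> exists (g : R) (z0 : 'rV[R]_m) (r : R),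
          [/\ (0 < g)%R, Z z0, (0 <= r < 1)%R
            & forall z, Z z ->
                (loss x z <= g * (1 + nrm (z - z0)%R `^ r))%R]].

Section games.
Context (R : realType) (S T : Type).
Implicit Types (X : set S) (P : set T) (f : S -> T -> \bar R).

Definition is_min_on (U : Type) (A : set U) (h : U -> \bar R) (u : U) : Prop :=
  A u /\ forall v, A v -> h u <= h v.

Definition is_max_on (U : Type) (A : set U) (h : U -> \bar R) (u : U) : Prop :=
  A u /\ forall v, A v -> h v <= h u.

Definition sup_over P f (x : S) : \bar R := ereal_sup [set f x q | q in P].

Definition inf_over X f (q : T) : \bar R := ereal_inf [set f x q | x in X].

Definition primal_value X P f : \bar R :=
  ereal_inf [set sup_over P f x | x in X].

Definition dual_value X P f : \bar R :=
  ereal_sup [set inf_over X f q | q in P].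

Definition saddle_point X P f (xs : S) (qs : T) : Prop :=
  [/\ X xs, P qs
    & forall x q, X x -> P q -> f xs q <= f xs qs /\ f xs qs <= f x qs].

(* The equality of values, with "min" and "max" instead of "inf" and "sup":
   the inner maximum is attained for every x, the two outer optima are
   attained, and the inner minimum is attained at an outer maximizer. It need
   not be attained at an arbitrary q. *)
Definition minmax_eq_maxmin X P f : Prop :=
  [/\ primal_value X P f = dual_value X P f,
      forall x, X x -> exists q, is_max_on P (f x) q,
      exists x, is_min_on X (sup_over P f) x
    & exists q, is_max_on P (inf_over X f) q /\
        exists x, is_min_on X (f ^~ q) x].

End games.

(* Main.v *)
Require Import Defs.
From HB Require Import structures.
From mathcomp Require Import ring lra measurable_realfun.

Set Implicit Arguments.
Unset Strict Implicit.
Unset Printing Implicit Defensive.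

Local Open Scope classical_set_scope.
Local Open Scope ring_scope.

(**
  The game reduces to a finite-dimensional one. A plan assigns to each pair
  (i, k) a mass w_ik and an atom z_ik, with sum_k w_ik = 1/(N+1); its loss at x
  is sum w_ik l_k(x, z_ik) and its cost is sum w_ik c(z_ik, zhat_i).

  Each feasible plan gives a measure of the ambiguity set with at least its
  loss, for all x simultaneously. Conversely, for fixed x, Lagrangian duality in
  the plane bounds the loss by lam c(z, zhat_i) + s(zhat_i), and integrating
  this against a coupling shows that no measure of the ambiguity set does better
  than the best plan at x.

  Plans can be averaged, concavely in the loss and convexly in the cost, and
  they are compact: vanishing masses may escape to infinity, but the growth
  condition makes their contribution to the loss nonpositive in the limit.
  Hence separation in R^j, applied to finitely many x at once, followed by
  compactness, yields one plan that is optimal against all x. The optimal x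
  exists because the value of the best plan is a supremum of continuous
  functions of x whose sublevel sets lie in the compact ones of the hypothesis.
*)

(** * Convex combinations and Jensen's inequality *)

Section convexity.
Context (R : realType) (E : lmodType R).

Lemma convex_functionP (D : set E) (f : E -> R) (t : R) (x y : E) :
  convex_function D f -> 0 <= t <= 1 -> D x -> D y ->
  f (t *: x + (1 - t) *: y) <= t * f x + (1 - t) * f y.
Proof.
move=> cf /andP[t0 t1] Dx Dy.
exact: (cf (Itv01 t0 t1) x y (mem_set Dx) (mem_set Dy)).
Qed.

Lemma convex_setP (D : set E) (t : R) (x y : E) :
  convex_set D -> 0 <= t <= 1 -> D x -> D y -> D (t *: x + (1 - t) *: y).
Proof.
move=> cD /andP[t0 t1] Dx Dy; apply: set_mem.
exact: (cD x y (Itv01 t0 t1) (mem_set Dx) (mem_set Dy)).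
Qed.

Lemma convexity_average (D : set E) (f : E -> R) (a b : R) (x y : E) :
  convex_set D -> convex_function D f -> 0 <= a -> 0 <= b -> 0 < a + b ->
  D x -> D y ->
  D ((a + b)^-1 *: (a *: x + b *: y)) /\
  f ((a + b)^-1 *: (a *: x + b *: y)) <= (a + b)^-1 * (a * f x + b * f y).
Proof.
move=> cD cf a0 b0 ab0 Dx Dy; pose t := a / (a + b).
have eb : b / (a + b) = 1 - t by rewrite /t; field; lra.
have t01 : 0 <= t <= 1.
  by rewrite divr_ge0 ?(ltW ab0)//= ler_pdivrMr// mul1r lerDl.
have -> : (a + b)^-1 *: (a *: x + b *: y) = t *: x + (1 - t) *: y.
  by rewrite scalerDr !scalerA -eb /t ![(a + b)^-1 * _]mulrC.
have -> : (a + b)^-1 * (a * f x + b * f y) = t * f x + (1 - t) * f y.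
  by rewrite -eb /t; field; lra.
by split; [exact: convex_setP|exact: convex_functionP].
Qed.

(** A starting point of positive weight keeps every partial weight positive, so the induction can
    absorb the head of [r] into [y] and renormalize. *)
Lemma jensen_from (I : Type) (D : set E) (f : E -> R) (w : I -> R) (x : I -> E)
    (r : seq I) (a : R) (y : E) :
  convex_set D -> convex_function D f ->
  (forall i, 0 <= w i) -> (forall i, D (x i)) -> 0 < a -> D y ->
  let s := a + \sum_(i <- r) w i in
  D (s^-1 *: (a *: y + \sum_(i <- r) w i *: x i)) /\
  f (s^-1 *: (a *: y + \sum_(i <- r) w i *: x i)) <=
    s^-1 * (a * f y + \sum_(i <- r) w i * f (x i)).
Proof.
move=> cD cf w0 Dx; elim: r a y => [|i r IH] a y a0 Dy /=.
  by rewrite !big_nil !addr0 scalerA mulVf ?gt_eqF// scale1r mulrA mulVf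
    ?gt_eqF// mul1r.
rewrite !big_cons !addrA.
have b0 : 0 < a + w i by rewrite ltr_wpDr.
have [Dy' fy'] := convexity_average cD cf (ltW a0) (w0 i) b0 Dy (Dx i).
have [] := IH _ _ b0 Dy'.
rewrite scalerA mulfV ?gt_eqF// scale1r => H1 H2; split => //.
apply: (le_trans H2); rewrite ler_wpM2l//.
  by rewrite invr_ge0 addr_ge0 ?sumr_ge0// ltW.
by rewrite lerD2r -ler_pdivlMl.
Qed.

Lemma jensen (I : finType) (D : set E) (f : E -> R) (w : I -> R) (x : I -> E) :
  convex_set D -> convex_function D f ->
  (forall i, 0 <= w i) -> (forall i, D (x i)) -> \sum_i w i = 1 ->
  D (\sum_i w i *: x i) /\ f (\sum_i w i *: x i) <= \sum_i w i * f (x i).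
Proof.
move=> cD cf w0 Dx w1.
have [i wi] : exists i, 0 < w i.
  apply: contrapT => /forallNP h; suff : \sum_i w i = 0 by rewrite w1; lra.
  by apply: big1 => i _; apply/eqP; rewrite eq_le w0 andbT leNgt; exact/negP.
have := @jensen_from I D f w x [seq j <- index_enum I | j != i] (w i) (x i)
  cD cf w0 Dx wi (Dx i).
rewrite /= !big_filter.
have -> : w i + \sum_(j | j != i) w j = 1 by rewrite -w1 [RHS](bigD1 i).
have -> : w i *: x i + \sum_(j | j != i) w j *: x j = \sum_j w j *: x j.
  by rewrite [RHS](bigD1 i).
have -> : w i * f (x i) + \sum_(j | j != i) w j * f (x j) =
    \sum_j w j * f (x j).
  by rewrite [RHS](bigD1 i).
by rewrite invr1 scale1r mul1r.
Qed.

Lemma convex_setT : convex_set [set: E].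
Proof. by move=> x y t _ _; apply: mem_set. Qed.

End convexity.

(** * Convex functions and equivalence of norms in finite dimension *)

Section finite_dimension.
Context (R : realType) (d : nat).
Implicit Types (f : 'rV[R]_d -> R) (h x y z : 'rV[R]_d).

Definition norm1 h : R := \sum_j `|h 0 j|.

Lemma norm1_ge0 h : 0 <= norm1 h.
Proof. exact: sumr_ge0. Qed.

Lemma norm1Z (a : R) h : norm1 (a *: h) = `|a| * norm1 h.
Proof.
by rewrite /norm1 mulr_sumr; apply: eq_bigr => j _; rewrite mxE normrM.
Qed.

Lemma norm1N h : norm1 (- h) = norm1 h.
Proof. by rewrite -scaleN1r norm1Z normrN1 mul1r. Qed.

Lemma le_coord_norm h j : `|h 0 j| <= `|h|.
Proof.
rewrite [leRHS]/Num.norm /= mx_normrE.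
by apply/bigmax_geP; right; exists (0, j).
Qed.

Lemma norm1_le h : norm1 h <= d%:R * `|h|.
Proof.
apply: (le_trans (ler_sum _ (fun j _ => le_coord_norm h j))).
by rewrite sumr_const card_ord mulr_natl.
Qed.

Lemma norm_le_norm1 h : `|h| <= norm1 h.
Proof.
rewrite [leLHS]/Num.norm /= mx_normrE; apply/bigmax_leP; split.
  exact: norm1_ge0.
move=> [i j] _ /=; rewrite /norm1 (bigD1 j)//= ord1 lerDl.
exact: sumr_ge0.
Qed.

Lemma norm1_continuous : continuous norm1.
Proof.
move=> x; apply: (@cvg_big _ _ _ _ _ _ _ (nbhs x)) => [|j _].
  exact: add_continuous.
by apply: cvg_norm; exact: coord_continuous.
Qed.

(** [x + h] is a convex combination of [x], with weight [1 - norm1 h], and of the points [x + e j]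
    or [x - e j], the sign being that of [h 0 j], with weights [|h 0 j|]. The constant collects the
    increments of [f] at these finitely many points. *)
Lemma convex_ball_bound f x : convex_function setT f ->
  exists2 M, 0 <= M &
    forall h, norm1 h < 1 -> f (x + h) <= f x + M * norm1 h.
Proof.
move=> cf; pose e (j : 'I_d) : 'rV[R]_d := delta_mx 0 j.
pose M := \sum_j (`|f (x + e j) - f x| + `|f (x - e j) - f x|).
exists M => [|h h1]; first by apply: sumr_ge0 => j _; rewrite addr_ge0.
pose sx j := x + Num.sg (h 0 j) *: e j.
have [_] := @jensen_from R _ 'I_d setT f (fun j => `|h 0 j|) sx
  (index_enum 'I_d) (1 - norm1 h) x (@convex_setT _ _) cf (fun=> normr_ge0 _)
  (fun=> I) (ltac:(by rewrite subr_gt0)) I.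
rewrite /= subrK invr1 scale1r mul1r.
have -> : (1 - norm1 h) *: x + \sum_j `|h 0 j| *: sx j = x + h.
  rewrite /sx; under eq_bigr do rewrite scalerDr scalerA mulrC -numEsg.
  rewrite big_split/= -scaler_suml addrA -scalerDl subrK scale1r; congr (_ + _).
  by rewrite [RHS]row_sum_delta.
move=> /le_trans; apply.
have : \sum_j `|h 0 j| * f (sx j) <= \sum_j `|h 0 j| * (f x + M).
  apply: ler_sum => j _; rewrite ler_wpM2l//.
  have Mj : `|f (x + e j) - f x| + `|f (x - e j) - f x| <= M.
    by rewrite /M (bigD1 j)//= lerDl; apply: sumr_ge0 => k _; rewrite addr_ge0.
  have := ler_norm (f (x + e j) - f x).
  have := ler_norm (f (x - e j) - f x).
  have := normr_ge0 (f (x + e j) - f x).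
  have := normr_ge0 (f (x - e j) - f x).
  rewrite /sx; case: sgrP => _; rewrite ?scale0r ?scale1r ?scaleN1r ?addr0; lra.
rewrite -mulr_suml -/(norm1 h); nra.
Qed.

(** The lower bound follows from the upper one by reflecting a small displacement through [x]. It
    extends to every [h] because a short initial piece of the segment from [x] to [x + h] stays in
    the unit ball, and convexity bounds [f (x + h)] from below by extrapolation. *)
Lemma convex_bound f x : convex_function setT f ->
  exists M, [/\ 0 <= M,
    forall h, norm1 h < 1 -> f (x + h) <= f x + M * norm1 h &
    forall h, f x - M * norm1 h <= f (x + h)].
Proof.
move=> cf; have [M M0 fM] := convex_ball_bound x cf; exists M; split => // h.
have small k : norm1 k < 1 -> f x - M * norm1 k <= f (x + k).
  move=> k1; have := fM (- k); rewrite norm1N => /(_ k1) fk.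
  have hlf : 0 <= (2^-1 : R) <= 1 by lra.
  have := @convex_functionP R _ setT f 2^-1 (x + k) (x - k) cf hlf I I.
  have -> : 2^-1 *: (x + k) + (1 - 2^-1) *: (x - k) = x.
    have -> : 1 - 2^-1 = (2^-1 : R) by lra.
    rewrite -scalerDr addrACA subrr addr0 scalerDr -scalerDl.
    by have -> : 2^-1 + 2^-1 = (1 : R) by [lra]; rewrite scale1r.
  lra.
have S0 := norm1_ge0 h; pose t := (1 + norm1 h)^-1.
have tS : t * (1 + norm1 h) = 1 by rewrite mulVf// gt_eqF//; lra.
have t0 : 0 < t by rewrite invr_gt0; lra.
have t1 : 0 <= t <= 1 by nra.
have := @convex_functionP R _ setT f t (x + h) x cf t1 I I.
have -> : t *: (x + h) + (1 - t) *: x = x + t *: h.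
  by rewrite scalerDr addrAC -scalerDl addrCA subrr addr0 scale1r.
have := small (t *: h); rewrite norm1Z gtr0_norm// => /(_ ltac:(nra)) h1 h2.
have : t * (f x - M * norm1 h) <= t * f (x + h) by nra.
by rewrite ler_pM2l.
Qed.

Lemma convex_continuous f : convex_function setT f -> continuous f.
Proof.
move=> cf x; have [M [M0 up lo]] := convex_bound x cf.
have cn : norm1 (y - x) @[y --> x] --> (0 : R).
  have -> : 0 = norm1 (x - x).
    by rewrite /norm1 big1// => j _; rewrite subrr mxE normr0.
  apply: (@continuous_comp _ _ _ (fun y => y - x) norm1 x).
    by apply: (@cvgB _ _ _ (nbhs x)); [exact: cvg_id|exact: cvg_cst].
  exact: norm1_continuous.
apply/(@cvgrPdist_le _ _ _ (nbhs x)) => e e0; near=> y.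
have y1 : norm1 (y - x) < 1.
  by near: y; apply: cvgr_lt cn _ _; exact: ltr01.
have y2 : norm1 (y - x) < e / (M + 1).
  by near: y; apply: cvgr_lt cn _ _; apply: divr_gt0 => //; lra.
have := up _ y1; have := lo (y - x); rewrite subrKC => h1 h2.
have : M * norm1 (y - x) <= e.
  have : M * norm1 (y - x) <= M * (e / (M + 1)) by rewrite ler_wpM2l// ltW.
  move/le_trans; apply.
  by rewrite mulrCA ger_pMr// ler_pdivrMr; lra.
by rewrite ler_norml => h3; apply/andP; split; lra.
Unshelve. all: by end_near. Qed.

(** A norm is convex, hence continuous, so it attains a positive minimum on the compact unit sphere
    of [norm1]; homogeneity does the rest. *)
Lemma norm1_le_norm nrm : is_norm nrm ->
  exists2 C, 0 < C & forall z, norm1 z <= C * nrm z.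
Proof.
move=> [tri hom def].
have nrmN z : nrm (- z) = nrm z by rewrite -scaleN1r hom normrN1 mul1r.
have nrm0 : nrm 0 = 0 by rewrite -(scale0r 0) hom normr0 mul0r.
have nrm_ge0 z : 0 <= nrm z.
  by have := tri z (- z); rewrite subrr nrm0 nrmN; lra.
have cvx : convex_function setT nrm.
  move=> t x y _ _; apply: (le_trans (tri _ _)); rewrite !hom.
  have t0 : 0 <= t%:num by [].
  have t1 : 0 <= 1 - t%:num by rewrite subr_ge0.
  by rewrite (ger0_norm t0) (ger0_norm t1).
(* The unit sphere is empty in dimension 0; then [norm1] vanishes identically and any constant
   serves. *)
have [[z0 z01]|emp] := pselect (exists z, norm1 z = 1); last first.
  exists 1 => // z; have [->|z0] := eqVneq (norm1 z) 0; first by rewrite mul1r.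
  case: emp; exists ((norm1 z)^-1 *: z).
  by rewrite norm1Z normfV ger0_norm ?norm1_ge0// mulVf.
have cptA : compact [set z | norm1 z = 1].
  apply: bounded_closed_compact.
    exists 1; split => // r r1 z /= z1; apply: (le_trans (norm_le_norm1 z)).
    by rewrite z1 ltW.
  rewrite (_ : [set z | _] = norm1 @^-1` [set x | x = 1])//.
  apply: preimage_closed; last exact: closed_eq.
  by move=> y _; exact: norm1_continuous.
have [y /set_mem/= y1 ymin] := compact_EVT_min (ex_intro _ z0 z01) cptA
  (continuous_subspaceT (convex_continuous cvx)).
have y0 : 0 < nrm y.
  rewrite lt_neqAle nrm_ge0 andbT eq_sym; apply/eqP => /def y0.
  by move: y1; rewrite y0 /norm1 big1 ?(eqP (oner_neq0 _))// => [/esym/eqP|j _];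
    rewrite ?oner_eq0// mxE normr0.
exists (nrm y)^-1; first by rewrite invr_gt0.
move=> z; have [->|z0'] := eqVneq (norm1 z) 0.
  by rewrite mulr_ge0// invr_ge0 ltW.
have zp : 0 < norm1 z by rewrite lt_neqAle eq_sym z0' norm1_ge0.
have := ymin ((norm1 z)^-1 *: z); rewrite hom gtr0_norm ?invr_gt0//.
rewrite ler_pdivlMl// mulrC => h; rewrite mulrC ler_pdivlMr// mulrC; apply: h.
by apply: mem_set; rewrite /= norm1Z gtr0_norm ?invr_gt0// mulVf.
Qed.

(** This is the global lower bound of [convex_bound] for the opposite function. *)
Lemma concave_growth f : concave_function setT f ->
  exists2 M, 0 <= M & forall z, f z <= f 0 + M * norm1 z.
Proof.
move=> cf; have [M [M0 _ lo]] := convex_bound 0 cf.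
by exists M => // z; have := lo z; rewrite add0r /=; lra.
Qed.

Lemma concave_continuous f : concave_function setT f -> continuous f.
Proof.
move=> /convex_continuous cf x.
have -> : f = (fun y => - (\- f) y) by apply/funext => y /=; rewrite opprK.
by apply: (@cvgN _ _ _ (nbhs x)); exact: cf.
Qed.

End finite_dimension.

(** * Separation from a convex set, and a finite minimax theorem *)

Section separation.
Context (R : realType) (j : nat).
Implicit Types (C : set 'rV[R]_j) (p u v w y : 'rV[R]_j).

Definition dot u v : R := \sum_i u 0 i * v 0 i.

Lemma dotDr w u v : dot w (u + v) = dot w u + dot w v.
Proof.
by rewrite /dot -big_split/=; apply: eq_bigr => i _; rewrite mxE mulrDr.
Qed.

Lemma dotZr w (a : R) u : dot w (a *: u) = a * dot w u.
Proof.
by rewrite /dot mulr_sumr; apply: eq_bigr => i _; rewrite mxE mulrCA.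
Qed.

Lemma dotC u v : dot u v = dot v u.
Proof. by apply: eq_bigr => i _; rewrite mulrC. Qed.

Lemma dot_ge0 v : 0 <= dot v v.
Proof. by apply: sumr_ge0 => i _; rewrite -expr2 sqr_ge0. Qed.

Lemma dot_sq v (t : R) u :
  dot (v - t *: u) (v - t *: u) = dot v v - 2 * t * dot v u + t ^+ 2 * dot u u.
Proof.
rewrite -scaleNr dotDr dotZr dotC dotDr dotZr (dotC (v + _) u) dotDr dotZr.
by rewrite (dotC u v); ring.
Qed.

Lemma norm_le_dot v : `|v| <= 1 + dot v v.
Proof.
have := dot_ge0 v => v0; rewrite [leLHS]/Num.norm /= mx_normrE.
apply/bigmax_leP; split; first lra.
move=> [i k] _ /=; rewrite ord1.
have : v 0 k * v 0 k <= dot v v.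
  rewrite /dot (bigD1 k)//= lerDl; apply: sumr_ge0 => l _.
  by rewrite -expr2 sqr_ge0.
by have := normr_ge0 (v 0 k); rewrite -expr2 -real_normK ?num_real//; nra.
Qed.

Lemma closure_convexl C (t : R) y z : convex_set C -> 0 <= t <= 1 ->
  closure C y -> C z -> closure C (t *: y + (1 - t) *: z).
Proof.
move=> cC t01 Cy Cz B Bn.
have : nbhs y ((fun y' => t *: y' + (1 - t) *: z) @^-1` B).
  suff : (t *: y' + (1 - t) *: z) @[y' --> y] --> t *: y + (1 - t) *: z by exact.
  by apply: (@cvgD _ _ _ (nbhs y));
    [apply: (@cvgZ _ _ _ (nbhs y)); [exact: cvg_cst|exact: cvg_id]
    |exact: cvg_cst].
move=> /Cy[y' [Cy' By']]; exists (t *: y' + (1 - t) *: z); split => //.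
exact: convex_setP.
Qed.

(** The vector [w] points from the nearest point [ys] of the closure of [C] to [p], and the gap is
    its squared length. The nearest point is found in a compact piece of the closure. *)
Lemma strict_separation C p : C !=set0 -> convex_set C -> ~ closure C p ->
  exists w, exists2 e, 0 < e & forall y, C y -> dot w y <= dot w p - e.
Proof.
move=> [y0 Cy0] cC Cp; pose q y := dot (p - y) (p - y).
have cq : continuous q.
  move=> y; apply: (@cvg_big _ _ _ _ _ _ _ (nbhs y)) => [|i _].
    exact: add_continuous.
  suff c : (p - y') 0 i @[y' --> y] --> (p - y) 0 i.
    by apply: (@cvgM _ _ (nbhs y)).
  apply: (@continuous_comp _ _ _ (fun y' => p - y') (fun M : 'rV[R]_j => M 0 i)).
    by apply: (@cvgB _ _ _ (nbhs y)); [exact: cvg_cst|exact: cvg_id].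
  exact: coord_continuous.
pose A := closure C `&` [set y | q y <= q y0].
have cA : compact A.
  apply: bounded_closed_compact.
    exists (`|p| + 1 + q y0); split; first exact: num_real.
    move=> r rM y [_ /= qy]; have := norm_le_dot (p - y) => h.
    have -> : y = p - (p - y) by rewrite opprB subrKC.
    by have := ler_normB p (p - y); rewrite /q in qy rM *; lra.
  apply: closedI; first exact: closed_closure.
  rewrite (_ : [set y | _] = q @^-1` [set r | r <= q y0])//.
  by apply: preimage_closed; [move=> y _; exact: cq|exact: closed_le].
have [ys /set_mem [Cys qys] ysmin] := compact_EVT_min
  (ex_intro _ y0 (conj (@subset_closure _ C _ Cy0) (lexx (q y0)))) cA
  (continuous_subspaceT cq).
pose w := p - ys; exists w.
have ww : 0 < dot w w.
  rewrite lt_neqAle dot_ge0 andbT eq_sym; apply/eqP => w0; apply: Cp.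
  suff -> : p = ys by [].
  apply/eqP; rewrite -subr_eq0; apply/eqP/rowP => i; rewrite [RHS]mxE.
  have : \sum_i w 0 i * w 0 i = 0 by [].
  move/psumr_eq0P => /(_ (fun k _ => ltac:(by rewrite -expr2 sqr_ge0)) i isT).
  by move/eqP; rewrite mulf_eq0 orbb => /eqP.
exists (dot w w) => // y Cy.
suff : dot w (y - ys) <= 0.
  have -> : dot w (y - ys) = dot w y - dot w ys.
    by rewrite -scaleN1r dotDr dotZr mulN1r.
  have : dot w w = dot w p - dot w ys.
    by rewrite [in X in dot _ X]/w -scaleN1r dotDr dotZr mulN1r.
  lra.
rewrite leNgt; apply/negP; set a := dot w _ => a0.
pose b := dot (y - ys) (y - ys); have b0 : 0 <= b by exact: dot_ge0.
(* Were [a] positive, moving from [ys] towards [y] by this fraction would come strictly closer to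
   [p]: the squared distance changes by [t ^ 2 * b - 2 * t * a], and [t * b <= a]. *)
pose t := a / (a + b).
have tab : t * (a + b) = a by rewrite divfK// gt_eqF//; lra.
have t0 : 0 < t by rewrite divr_gt0//; lra.
have t1 : t <= 1 by nra.
pose yt := (1 - t) *: ys + (1 - (1 - t)) *: y.
have Cyt : closure C yt by apply: closure_convexl => //; lra.
have e : p - yt = w - t *: (y - ys).
  rewrite /yt /w opprB addrCA subrr addr0 scalerBl scale1r scalerBr !opprD !opprK.
  by rewrite !addrA addrAC.
have qyt : dot w w <= q yt.
  have [qy|/ltW qy] := leP (q yt) (q y0); first by apply: ysmin; exact: mem_set.
  exact: le_trans qys qy.
move: qyt; rewrite /q e dot_sq -/a -/b => h.
have : 2 * a <= t * b by nra.
nra.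
Qed.

End separation.

(** The vectors dominated by some value of [u] form a convex set [C]. If its closure misses 0, a
    separating vector has nonnegative entries because [C] is closed downwards; normalized to total
    weight 1, it contradicts the averaged hypothesis. *)
Lemma concavelike_finite_minimax (R : realType) (Th : Type) (T : set Th)
    (j : nat) (u : Th -> 'I_j -> R) :
  T !=set0 ->
  (forall th1 th2 t, T th1 -> T th2 -> 0 <= t <= 1 ->
    exists2 th, T th & forall i, t * u th1 i + (1 - t) * u th2 i <= u th i) ->
  (forall w : 'I_j -> R, (forall i, 0 <= w i) -> \sum_i w i = 1 ->
    exists2 th, T th & 0 <= \sum_i w i * u th i) ->
  forall e, 0 < e -> exists2 th, T th & forall i, - e <= u th i.
Proof.
move=> [th0 T0] mix hw e e0.
pose C : set 'rV[R]_j := [set y | exists2 th, T th & forall i, y 0 i <= u th i].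
have C0 : C (\row_i u th0 i) by exists th0 => // i; rewrite mxE.
have cC : convex_set C.
  move=> y1 y2 t /set_mem [th1 T1 h1] /set_mem [th2 T2 h2]; apply: mem_set.
  have t0 : 0 <= t%:num by [].
  have t1 : 0 <= 1 - t%:num by rewrite subr_ge0.
  have [|th Th' h] := mix th1 th2 t%:num T1 T2.
    by rewrite t0 -subr_ge0 t1.
  exists th => // i; apply: le_trans (h i); rewrite !mxE.
  by rewrite lerD// ler_wpM2l.
have [C0'|nC] := pselect (closure C 0).
  have [y [[th Tth yth] /= ye]] := C0' _ (nbhsx_ballx (0 : 'rV[R]_j) _ e0).
  exists th => // i; apply: le_trans (yth i).
  move: ye; rewrite mx_norm_ball /ball_ /= sub0r normrN => ye.
  have := le_lt_trans (le_coord_norm y i) ye.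
  by rewrite ltr_norml => /andP[/ltW].
have [w [d d0 sep]] := strict_separation (ex_intro _ _ C0) cC nC.
have dw0 : dot w 0 = 0 by rewrite /dot big1// => i _; rewrite mxE mulr0.
have wpos i : 0 <= w 0 i.
  rewrite leNgt; apply/negP => wi.
  pose y0 : 'rV[R]_j := \row_i u th0 i.
  (* Lowering the coordinate of negative weight by this amount makes the product with [w] at least
     1, against the separation. *)
  pose s := (1 + `|dot w y0|) / - w 0 i.
  have s0 : 0 <= s by rewrite divr_ge0 ?addr_ge0// oppr_ge0 ltW.
  have := sep (y0 + (- s) *: delta_mx 0 i); rewrite dotDr dotZr dw0.
  have -> : dot w (delta_mx 0 i) = w 0 i.
    rewrite /dot (bigD1 i)//= mxE !eqxx mulr1 big1 ?addr0// => k ki.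
    by rewrite mxE (negbTE ki) andbF mulr0.
  have -> : - s * w 0 i = 1 + `|dot w y0|.
    by rewrite mulNr -mulrN divfK// oppr_eq0 lt_eqF.
  have Cy : C (y0 + - s *: delta_mx 0 i).
    exists th0 => // k; rewrite !mxE gerDl mulNr oppr_le0 mulr_ge0//.
  by move=> /(_ Cy); have := ler_norm (- dot w y0); rewrite normrN; lra.
have W0 : 0 < \sum_i w 0 i.
  rewrite lt_neqAle eq_sym sumr_ge0// andbT; apply/eqP => W0.
  have wi i : w 0 i = 0 by apply: (psumr_eq0P _ W0) => // k _; exact: wpos.
  have := sep _ C0; rewrite dw0 /dot big1 => [|i _]; last by rewrite wi mul0r.
  lra.
have [||th Tth] := hw (fun i => w 0 i / \sum_i w 0 i).
- by move=> i; rewrite divr_ge0// ltW.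
- by rewrite -mulr_suml mulfV// gt_eqF.
have -> : \sum_i w 0 i / (\sum_i w 0 i) * u th i =
    (\sum_i w 0 i)^-1 * dot w (\row_i u th i).
  by rewrite /dot mulr_sumr; apply: eq_bigr => i _; rewrite mxE mulrAC mulrC.
rewrite pmulr_rge0 ?invr_gt0// => h.
have := sep (\row_i u th i); rewrite dw0 => /(_ _)/(le_trans h).
suff : C (\row_i u th i) by move=> Cth /(_ Cth); lra.
by exists th => // i; rewrite mxE.
Qed.

(** * Growth of the loss against the transportation cost *)

Section growth.
Context (R : realType).

(** At the threshold [S] one has [e * S ^ (q - r) = 1]: below it the constant [S ^ r] suffices,
    above it the term in [s ^ q] does. *)
Lemma powR_dominated (r q e : R) : 0 <= r < q -> 0 < e ->
  exists2 D, 0 <= D & forall s, 0 <= s -> s `^ r <= D + e * s `^ q.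
Proof.
move=> /andP[r0 rq] e0; pose S := e^-1 `^ (q - r)^-1.
have qr : 0 < q - r by rewrite subr_gt0.
exists (S `^ r) => [|s s0]; first exact: powR_ge0.
have [sS|/ltW sS] := leP s S.
  rewrite -[leLHS]addr0 lerD// ?mulr_ge0 ?powR_ge0 ?(ltW e0)//.
  by apply: ge0_ler_powR; rewrite ?nnegrE ?powR_ge0.
rewrite -[leLHS]add0r lerD ?powR_ge0//.
have -> : s `^ q = s `^ r * s `^ (q - r).
  rewrite -powRD ?subrKC//; apply/implyP => /eqP; lra.
rewrite mulrCA ler_peMr ?powR_ge0// mulrC -ler_pdivrMr// div1r.
have -> : e^-1 = S `^ (q - r).
  by rewrite -powRrM mulVf ?gt_eqF// powRr1// invr_ge0 ltW.
by apply: ge0_ler_powR; rewrite ?nnegrE ?powR_ge0// ltW.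
Qed.

Context (n m N K : nat) (X : set 'rV[R]_n) (Z : set 'rV[R]_m)
  (c : 'rV[R]_m -> 'rV[R]_m -> R) (zhat : 'I_N.+1 -> 'rV[R]_m)
  (l : 'I_K.+1 -> 'rV[R]_n -> 'rV[R]_m -> R).

Lemma le_max_loss k x z : l k x z <= max_loss l x z.
Proof. by rewrite /max_loss; apply: (le_bigmax _ (fun k => l k x z)). Qed.

Lemma max_loss_attained x z : exists k, max_loss l x z = l k x z.
Proof.
rewrite /max_loss; elim/big_ind : _ => [|a b [i ->] [j ->]|k _].
- by exists ord0.
- by rewrite maxEle; case: ifP; [exists j|exists i].
- by exists k.
Qed.

Lemma transport_cost_coercive : growth_condition X Z c (max_loss l) ->
  (forall i, Z (zhat i)) ->
  forall i t, exists B, forall z, Z z -> c z (zhat i) <= t -> `|z| <= B.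
Proof.
move=> [nrm [p [nrmP p1 cp _]]] hz i t.
have [C C0 n1] := norm1_le_norm nrmP; have [tri _ _] := nrmP.
exists (C * (1 + `|t| + nrm (zhat i))) => z Zz ct.
apply: (le_trans (norm_le_norm1 z)); apply: (le_trans (n1 z)).
rewrite ler_wpM2l ?(ltW C0)//.
have := tri (z - zhat i) (zhat i); rewrite subrK => /le_trans; apply.
rewrite lerD2r; have [a1|/ltW a1] := leP (nrm (z - zhat i)) 1.
  by rewrite (le_trans a1)// lerDl.
have := ler_powR a1 p1; rewrite powRr1 ?(le_trans ler01)// => /le_trans; apply.
apply: (le_trans (cp _ _ Zz (hz i))); apply: (le_trans ct).
by have := ler_norm t; lra.
Qed.

(** Growth slower than the cost is absorbed by an arbitrarily small multiple of it. For [p > 1] the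
    slower growth is the linear growth of a concave function; for [p = 1] it is the assumed exponent
    [r < 1]. *)
Lemma loss_dominated_by_cost : growth_condition X Z c (max_loss l) ->
  (forall i, Z (zhat i)) -> (forall k x, concave_function setT (l k x)) ->
  forall x e, X x -> 0 < e ->
  exists2 C, 0 <= C &
    forall i k z, Z z -> l k x z <= C + e * c z (zhat i).
Proof.
move=> [nrm [p [nrmP p1 cp hp]]] hz hl x e Xx e0.
suff /choice[C hC] : forall ik : 'I_N.+1 * 'I_K.+1, exists C, forall z, Z z ->
    l ik.2 x z <= C + e * c z (zhat ik.1).
  exists (\sum_ik `|C ik|) => [|i k z Zz]; first exact: sumr_ge0.
  apply: (le_trans (hC (i, k) z Zz)); rewrite lerD2r.
  rewrite (bigD1 (i, k))//= (le_trans (ler_norm _))// lerDl.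
  exact: sumr_ge0.
move=> [i k] /=; have [tri hom _] := nrmP.
have nrmN z : nrm (- z) = nrm z by rewrite -scaleN1r hom normrN1 mul1r.
have nrm0 : nrm 0 = 0 by rewrite -(scale0r 0) hom normr0 mul0r.
have nrm_ge0 z : 0 <= nrm z.
  by have := tri z (- z); rewrite subrr nrm0 nrmN; lra.
have [/esym p1'|p1'] := eqVneq 1 p; last first.
  have [M M0 lM] := concave_growth (hl k x).
  have [C1 C10 n1] := norm1_le_norm nrmP.
  have MC : 0 <= M * C1 by rewrite mulr_ge0// ltW.
  have [||D D0 hD] := @powR_dominated 1 p (e / (M * C1 + 1)).
  - by rewrite ler01/= lt_neqAle p1'.
  - by rewrite divr_gt0//; lra.
  exists (l k x 0 + M * C1 * (D + nrm (zhat i))) => z Zz.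
  apply: (le_trans (lM z)); rewrite -addrA lerD2l.
  apply: (@le_trans _ _ (M * C1 * nrm z)); first by rewrite -mulrA ler_wpM2l.
  have := tri (z - zhat i) (zhat i); rewrite subrK => h1.
  have := hD _ (nrm_ge0 (z - zhat i)); rewrite powRr1// => h2.
  have h3 := cp _ _ Zz (hz i).
  apply: (@le_trans _ _ (M * C1 * (D + e / (M * C1 + 1) * c z (zhat i)
                          + nrm (zhat i)))).
    rewrite ler_wpM2l//; apply: (le_trans h1); rewrite lerD2r.
    apply: (le_trans h2); rewrite lerD2l ler_wpM2l//.
    by rewrite divr_ge0 ?(ltW e0)//; lra.
  rewrite addrAC [leLHS]mulrDr lerD2l mulrA.
  have c0 : 0 <= c z (zhat i) by exact: le_trans (powR_ge0 _ _) h3.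
  by rewrite ler_wpM2r// mulrCA ger_pMr// ler_pdivrMr; lra.
have [g [z0 [r [g0 Zz0 /andP[r0 r1] hg]]]] := hp p1' x Xx.
have [||D D0 hD] := @powR_dominated r 1 (e / g).
- by rewrite r0.
- by rewrite divr_gt0.
exists (g + g * D + e * nrm (zhat i - z0)) => z Zz.
apply: (le_trans (le_max_loss k x z)); apply: (le_trans (hg z Zz)).
have := hD _ (nrm_ge0 (z - z0)); rewrite powRr1// => h1.
have h3 : nrm (z - zhat i) <= c z (zhat i).
  by have := cp _ _ Zz (hz i); rewrite p1' powRr1.
have := tri (z - zhat i) (zhat i - z0); rewrite addrA subrK => h2.
have : g * nrm (z - z0) `^ r <= g * (D + e / g * nrm (z - z0)).
  by rewrite ler_pM2l.
have -> : g * (D + e / g * nrm (z - z0)) = g * D + e * nrm (z - z0).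
  by field; rewrite gt_eqF.
have : e * nrm (z - z0) <= e * (c z (zhat i) + nrm (zhat i - z0)).
  by rewrite ler_pM2l//; lra.
rewrite mulrDr mulrDr mulr1; lra.
Qed.

End growth.

(** * Limits along ultrafilters *)

Section ultrafilter_limits.

Lemma ultra_fmap (T U : Type) (f : T -> U) (G : set_system T) :
  UltraFilter G -> UltraFilter (f @ G).
Proof.
move=> UG; split; first exact: fmap_proper_filter.
move=> H PH GH; apply/seteqP; split => // A HA.
have [//|GA] := in_ultra_setVsetC (f @^-1` A) UG.
have HA' : H (~` A) by apply: GH.
by have /filter_ex[? []] : H (A `&` ~` A) by exact: filterI.
Qed.

Lemma ultra_cvg_compact (T : Type) (U : topologicalType) (f : T -> U)
    (G : set_system T) (A : set U) :
  UltraFilter G -> compact A -> (\forall t \near G, A (f t)) ->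
  exists2 y, A y & f t @[t --> G] --> y.
Proof.
move=> UG; rewrite compact_ultra => cA GA.
by have [y [Ay Gy]] := cA _ (ultra_fmap f UG) GA; exists y.
Qed.

End ultrafilter_limits.

(** * Transport plans: mixing and compactness *)

Section plans.
Context (R : realType) (n m N K : nat) (X : set 'rV[R]_n) (Z : set 'rV[R]_m)
  (c : 'rV[R]_m -> 'rV[R]_m -> R) (zhat : 'I_N.+1 -> 'rV[R]_m)
  (l : 'I_K.+1 -> 'rV[R]_n -> 'rV[R]_m -> R).

(* A plan moves mass [th.1 (i, k)] from [zhat i] to the atom [th.2 (i, k)], at
   which only the k-th piece of the loss is charged. *)
Definition plan : Type :=
  ('I_N.+1 * 'I_K.+1 -> R) * ('I_N.+1 * 'I_K.+1 -> 'rV[R]_m).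

Definition admissible : set plan :=
  [set th | [/\ forall ik, 0 <= th.1 ik,
      forall i, \sum_k th.1 (i, k) = N.+1%:R^-1 & forall ik, Z (th.2 ik)]].

Definition plan_loss (x : 'rV[R]_n) (th : plan) : R :=
  \sum_ik th.1 ik * l ik.2 x (th.2 ik).

Definition plan_cost (th : plan) : R :=
  \sum_ik th.1 ik * c (th.2 ik) (zhat ik.1).

Lemma admissible_sum1 th : admissible th -> \sum_ik th.1 ik = 1.
Proof.
move=> [_ th1 _].
rewrite (eq_bigr (fun ik => th.1 (ik.1, ik.2))); last by case.
rewrite -(pair_bigA _ (fun i k => th.1 (i, k)))/=.
rewrite (eq_bigr (fun=> N.+1%:R^-1)) => [|i _]; last exact: th1.
by rewrite sumr_const card_ord -[LHS]mulr_natl mulfV// pnatr_eq0.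
Qed.

(** Masses mix linearly and the two atoms are replaced by their barycentre, weighted by mass. The
    products of mass and value then behave like perspective functions: convexly for the cost,
    concavely for each piece of the loss. *)
Lemma plan_mix (hZ : convex_set Z)
    (hc : forall i, convex_function Z (c ^~ (zhat i)))
    (hl : forall k x, concave_function setT (l k x)) th1 th2 (t : R) :
  admissible th1 -> admissible th2 -> 0 <= t <= 1 ->
  exists th, [/\ admissible th,
    forall x, t * plan_loss x th1 + (1 - t) * plan_loss x th2 <= plan_loss x th
    & plan_cost th <= t * plan_cost th1 + (1 - t) * plan_cost th2].
Proof.
move=> [w10 s1 Z1] [w20 s2 Z2] /andP[t0 t1].
have t1' : 0 <= 1 - t by rewrite subr_ge0.
pose a ik := t * th1.1 ik; pose b ik := (1 - t) * th2.1 ik.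
have a0 ik : 0 <= a ik by rewrite mulr_ge0.
have b0 ik : 0 <= b ik by rewrite mulr_ge0.
(* Where both masses vanish the barycentre is undefined; any point of [Z] will do. *)
pose z ik := if a ik + b ik == 0 then th1.2 ik
  else (a ik + b ik)^-1 *: (a ik *: th1.2 ik + b ik *: th2.2 ik).
have avg D (f : 'rV[R]_m -> R) ik : convex_set D -> convex_function D f ->
    D (th1.2 ik) -> D (th2.2 ik) -> D (z ik) /\
    (a ik + b ik) * f (z ik) <= a ik * f (th1.2 ik) + b ik * f (th2.2 ik).
  move=> cD cf D1 D2; rewrite /z; case: ifPn => [/eqP ab|ab].
    have [-> ->] : a ik = 0 /\ b ik = 0 by have := a0 ik; have := b0 ik; lra.
    by rewrite addr0 !mul0r addr0.
  have ab0 : 0 < a ik + b ik by rewrite lt_neqAle eq_sym ab addr_ge0.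
  have [Dz fz] := convexity_average cD cf (a0 ik) (b0 ik) ab0 D1 D2.
  by split=> //; rewrite -ler_pdivlMl.
exists (fun ik => a ik + b ik, z); split.
- split => /= [ik|i|ik]; first by rewrite addr_ge0.
    by rewrite big_split/= -!mulr_sumr s1 s2; ring.
  by have [] := avg Z (c ^~ (zhat ik.1)) ik hZ (hc _) (Z1 _) (Z2 _).
- move=> x; rewrite /plan_loss !mulr_sumr -big_split/=; apply: ler_sum => ik _.
  have [_] := avg setT (\- l ik.2 x) ik (@convex_setT _ _) (hl _ _) I I.
  by rewrite /= !mulrN !mulrA /a /b; lra.
- rewrite /plan_cost !mulr_sumr -big_split/=; apply: ler_sum => ik _.
  have [_] := avg Z (c ^~ (zhat ik.1)) ik hZ (hc _) (Z1 _) (Z2 _).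
  by rewrite !mulrA.
Qed.

Context (hZc : closed Z) (hzhat : forall i, Z (zhat i))
  (c_ge0 : forall i z, Z z -> 0 <= c z (zhat i))
  (c_lsc : forall i z a, Z z -> a < c z (zhat i) ->
    \forall z' \near z, Z z' -> a < c z' (zhat i))
  (c_coercive : forall i t, exists B, forall z, Z z -> c z (zhat i) <= t ->
    `|z| <= B)
  (l_continuous : forall k x, continuous (l k x))
  (l_dominated : forall x e, X x -> 0 < e -> exists2 C, 0 <= C &
    forall i k z, Z z -> l k x z <= C + e * c z (zhat i)).

Lemma plan_cost_term th ik : admissible th ->
  th.1 ik * c (th.2 ik) (zhat ik.1) <= plan_cost th.
Proof.
move=> [w0 _ Zth]; rewrite /plan_cost (bigD1 ik)//= lerDl.
by apply: sumr_ge0 => jk _; rewrite mulr_ge0// c_ge0.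
Qed.

(* Mass that vanishes in the limit may escape to infinity; by [l_dominated] it
   contributes nothing positive to the loss, so its atom is reset to [zhat i],
   at no cost. *)
Lemma plan_ultra_limit (G : set_system plan) (B : R) : UltraFilter G ->
  G admissible -> (\forall th \near G, plan_cost th <= B) ->
  exists ths, [/\ admissible ths,
    forall x a, X x -> (\forall th \near G, a <= plan_loss x th) ->
      a <= plan_loss x ths
    & forall b, (\forall th \near G, plan_cost th <= b) ->
      plan_cost ths <= b].
Proof.
move=> UG Gadm GB.
have /choice[ws ws_cvg] : forall ik, exists w : R,
    0 <= w /\ th.1 ik @[th --> G] --> w.
  move=> ik; have := @ultra_cvg_compact _ R^o (fun th : plan => th.1 ik) G
    `[0, 1]%classic UG (@segment_compact _ _ _).
  case=> [|w]; last first.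
    by rewrite /= in_itv/= => /andP[w0 _]; exists w.
  apply: filterS Gadm => th adm /=; rewrite in_itv/=.
  have [w0 _ _] := adm; rewrite w0 -(admissible_sum1 adm) (bigD1 ik)//= lerDl.
  by apply: sumr_ge0.
have /choice[zs zsP] : forall ik, exists z, [/\ Z z,
    ws ik = 0 -> z = zhat ik.1 & ws ik != 0 -> th.2 ik @[th --> G] --> z].
  move=> ik; have [w0 wc] := ws_cvg ik.
  have [ws0|ws0] := eqVneq (ws ik) 0; first by exists (zhat ik.1).
  have wp : 0 < ws ik by rewrite lt_neqAle eq_sym ws0.
  (* Eventually the mass exceeds [ws ik / 2] while the cost stays below [|B|], so the unit cost of
     the atom is at most this level and coercivity confines the atom to a compact set. *)
  have [M hM] := c_coercive ik.1 (2 * `|B| / ws ik).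
  have cA : compact (Z `&` [set z | `|z| <= M]).
    apply: bounded_closed_compact.
      exists M; split; first exact: num_real.
      by move=> r rM z [_ /= zM]; rewrite (le_trans zM)// ltW.
    apply: closedI => //.
    rewrite (_ : [set z | _] = Num.norm @^-1` [set r | r <= M])//.
    by apply: preimage_closed; [move=> y _; exact: norm_continuous|
      exact: closed_le].
  have [|z [Zz _] zc] := @ultra_cvg_compact _ _ (fun th : plan => th.2 ik) G _ UG cA.
    have Gw : \forall th \near G, ws ik / 2 < th.1 ik.
      by apply: (cvgr_gt _ wc); rewrite ltr_pdivrMr//; lra.
    apply: filterS3 Gadm GB Gw => th adm hB hw; have [_ _ Zth] := adm.
    split => //=; apply: hM => //; rewrite ler_pdivlMr//.
    have := plan_cost_term ik adm; have := ler_norm B.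
    by have := c_ge0 ik.1 (Zth ik); nra.
  by exists z; split => // /eqP; rewrite (negbTE ws0).
pose ths : plan := (ws, zs).
have ths_adm : admissible ths.
  split => /= [ik|i|ik]; [by have [] := ws_cvg ik| |by have [] := zsP ik].
  have h1 : \sum_k th.1 (i, k) @[th --> G] --> \sum_k ws (i, k).
    apply: cvg_big => [|k _]; first exact: add_continuous.
    by have [] := ws_cvg (i, k).
  have h2 : \sum_k th.1 (i, k) @[th --> G] --> (N.+1%:R^-1 : R).
    by apply: cvg_near_cst; apply: filterS Gadm => th [_ + _]; exact.
  exact: (@cvg_unique _ (@norm_hausdorff _ R^o) _ _ _ _ h1 h2).
have loss_term x ik e : X x -> 0 < e -> \forall th \near G,
    th.1 ik * l ik.2 x (th.2 ik) <= ws ik * l ik.2 x (zs ik) + e.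
  move=> Xx e0; have [w0 wc] := ws_cvg ik; have [Zz z0 zc] := zsP ik.
  have [ws0|ws0] := eqVneq (ws ik) 0; last first.
    have h : th.1 ik * l ik.2 x (th.2 ik) @[th --> G] -->
        ws ik * l ik.2 x (zs ik).
      apply: cvgM => //; apply: (@cvg_comp _ _ _ _ (l ik.2 x) _ _ _ (zc ws0)).
      exact: l_continuous.
    by apply: (cvgr_le _ h); rewrite ltrDl.
  rewrite ws0 mul0r add0r.
  have B1 : 0 < 2 * (`|B| + 1) by have := normr_ge0 B; lra.
  (* For vanishing mass the error splits in two: this rate holds the cost part to [e / 2], and a
     mass below [e / (2 * (C + 1))] holds the constant part to [e / 2]. *)
  have [C C0 hC] := l_dominated Xx (divr_gt0 e0 B1).
  have Gw : \forall th \near G, th.1 ik < e / (2 * (C + 1)).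
    by apply: (cvgr_lt _ wc); rewrite ws0 divr_gt0//; lra.
  apply: filterS3 Gadm GB Gw => th adm hB hw; have [wth _ Zth] := adm.
  have h1 := hC ik.1 ik.2 _ (Zth ik).
  have h2 := plan_cost_term ik adm.
  have h3 : th.1 ik * c (th.2 ik) (zhat ik.1) <= `|B| + 1.
    by have := ler_norm B; lra.
  apply: (le_trans (ler_wpM2l (wth ik) h1)).
  rewrite mulrDr mulrCA.
  have : e / (2 * (`|B| + 1)) * (th.1 ik * c (th.2 ik) (zhat ik.1)) <= e / 2.
    rewrite (@le_trans _ _ (e / (2 * (`|B| + 1)) * (`|B| + 1)))//.
      by rewrite ler_wpM2l// ltW// divr_gt0.
    by rewrite le_eqVlt; apply/orP; left; apply/eqP; field; rewrite gt_eqF//;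
      have := normr_ge0 B; lra.
  have : th.1 ik * C <= e / 2.
    apply: (@le_trans _ _ (e / (2 * (C + 1)) * C)).
      by rewrite ler_wpM2r// ltW.
    by rewrite invfM mulrA -[leLHS]mulrA ger_pMr ?divr_gt0// mulrC
      ler_pdivrMr; lra.
  lra.
have cost_term ik e : 0 < e -> \forall th \near G,
    ws ik * c (zs ik) (zhat ik.1) - e <= th.1 ik * c (th.2 ik) (zhat ik.1).
  move=> e0; have [w0 wc] := ws_cvg ik; have [Zz z0 zc] := zsP ik.
  have [ws0|ws0] := eqVneq (ws ik) 0.
    rewrite ws0 mul0r; apply: filterS Gadm => th [wth _ Zth].
    by have := mulr_ge0 (wth ik) (c_ge0 ik.1 (Zth ik)); lra.
  have wp : 0 < ws ik by rewrite lt_neqAle eq_sym ws0.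
  (* At the limiting mass, a drop of the unit cost by [d] weighs [e / 2]; the other half of [e] pays
     for the convergence of the mass. *)
  set cs := c (zs ik) (zhat ik.1); pose d := e / (2 * ws ik).
  have d0 : 0 < d by rewrite divr_gt0//; lra.
  have Gc : \forall th \near G, Z (th.2 ik) -> cs - d < c (th.2 ik) (zhat ik.1).
    have csd : cs - d < cs by rewrite ltrBlDr ltrDl.
    exact: (zc ws0 _ (c_lsc Zz csd)).
  have Gw : \forall th \near G, ws ik * (cs - d) - e / 2 < th.1 ik * (cs - d).
    have h : th.1 ik * (cs - d) @[th --> G] --> ws ik * (cs - d).
      by apply: cvgM => //; exact: cvg_cst.
    by apply: (cvgr_gt _ h); rewrite ltrBlDr ltrDl divr_gt0.
  apply: filterS3 Gadm Gc Gw => th [wth _ Zth] /(_ (Zth ik)) hc hw.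
  have := ler_wpM2l (wth ik) (ltW hc).
  have : ws ik * d = e / 2 by rewrite /d; field; rewrite gt_eqF.
  lra.
exists ths; split => //.
- move=> x a Xx Ga; apply/ler_addgt0Pr => e e0.
  pose M : R := #|{: 'I_N.+1 * 'I_K.+1}|%:R; have M0 : 0 <= M by exact: ler0n.
  have M1 : 0 < M + 1 by lra.
  have [th [h1 h2]] := filter_ex (filterI Ga (filter_forall _
    (fun ik => loss_term x ik _ Xx (divr_gt0 e0 M1)))).
  apply: (le_trans h1); apply: (le_trans (ler_sum _ (fun ik _ => h2 ik))).
  rewrite big_split/= sumr_const -[X in _ + X]mulr_natl lerD2l.
  by rewrite mulrCA ger_pMr// ler_pdivrMr//; rewrite /M in M1 *; lra.
- move=> b Gb; apply/ler_addgt0Pr => e e0.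
  pose M : R := #|{: 'I_N.+1 * 'I_K.+1}|%:R; have M0 : 0 <= M by exact: ler0n.
  have M1 : 0 < M + 1 by lra.
  have [th [h1 h2]] := filter_ex (filterI Gb (filter_forall _
    (fun ik => cost_term ik _ (divr_gt0 e0 M1)))).
  have : \sum_ik (ws ik * c (zs ik) (zhat ik.1) - e / (M + 1)) <= plan_cost th.
    by apply: ler_sum => ik _; exact: h2.
  rewrite sumrB sumr_const -/(plan_cost ths) -[X in _ - X]mulr_natl.
  suff : M * (e / (M + 1)) <= e by rewrite /M; lra.
  by rewrite mulrCA ger_pMr// ler_pdivrMr//; lra.
Qed.

(** A pair [(x, v)] in [S] demands a loss of at least [v] at [x]. The plans meeting finitely many
    demands up to a slack form a filter base, and the limit along a finer ultrafilter meets all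
    demands without slack. *)
Lemma plan_compactness (S : set ('rV[R]_n * R)) (rho : R) :
  (forall q, S q -> X q.1) ->
  (forall (s : seq ('rV[R]_n * R)) e, (forall q, q \in s -> S q) -> 0 < e ->
    exists th, [/\ admissible th, plan_cost th <= rho + e &
      forall q, q \in s -> q.2 - e <= plan_loss q.1 th]) ->
  exists th, [/\ admissible th, plan_cost th <= rho &
    forall q, S q -> q.2 <= plan_loss q.1 th].
Proof.
move=> SX hS.
pose D : set (seq ('rV[R]_n * R) * R) :=
  [set se : seq ('rV[R]_n * R) * R |
    (forall q, q \in se.1 -> S q) /\ 0 < se.2].
pose Bs (se : seq ('rV[R]_n * R) * R) : set plan :=
  [set th | [/\ admissible th, plan_cost th <= rho + se.2 &
    forall q, q \in se.1 -> q.2 - se.2 <= plan_loss q.1 th]].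
have FF : Filter (filter_from D Bs).
  apply: filter_from_filter; first by exists ([::], 1); split.
  move=> [s1 e1] [s2 e2] [/= S1 e10] [/= S2 e20].
  exists (s1 ++ s2, Num.min e1 e2).
    split => /= [q|]; last by rewrite lt_min e10.
    by rewrite mem_cat => /orP[/S1|/S2].
  move=> th [/= adm hc hq].
  have m1 : Num.min e1 e2 <= e1 by rewrite ge_min lexx.
  have m2 : Num.min e1 e2 <= e2 by rewrite ge_min lexx orbT.
  split; split => //=; try lra; move=> q qs.
    by have := hq q; rewrite mem_cat qs => /(_ isT); lra.
  by have := hq q; rewrite mem_cat qs orbT => /(_ isT); lra.
have PF : ProperFilter (filter_from D Bs).
  by apply: filter_from_proper => -[s e] [/= Ss e0]; exact: hS.
have [G [UG FG]] := ultraFilterLemma PF.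
have near_base s e : (forall q, q \in s -> S q) -> 0 < e -> G (Bs (s, e)).
  by move=> Ss e0; apply: FG; exists (s, e).
have G0 e (e0 : 0 < e) : G (Bs ([::], e)) by exact: near_base.
(* One fixed budget suffices for the limit to exist; the budget [rho] is recovered by letting the
   slack tend to 0. *)
have [||ths [adm hl hc]] := @plan_ultra_limit G (rho + 1) UG.
- by apply: filterS (G0 _ ltr01) => th [].
- by apply: filterS (G0 _ ltr01) => th [].
exists ths; split => //.
  apply/ler_addgt0Pr => e e0; apply: hc.
  by apply: filterS (G0 _ e0) => th [].
move=> q Sq; apply/ler_addgt0Pr => e e0; rewrite -lerBlDr; apply: hl.
  exact: SX.
have : G (Bs ([:: q], e)) by apply: near_base => // q'; rewrite inE => /eqP ->.
by apply: filterS => th [_ _]; apply; rewrite inE.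
Qed.

End plans.

(** * Minimax and Lagrangian duality for plans *)

Section plan_game.
Context (R : realType) (n m N K : nat)
  (X : set 'rV[R]_n) (Z : set 'rV[R]_m)
  (c : 'rV[R]_m -> 'rV[R]_m -> R)
  (zhat : 'I_N.+1 -> 'rV[R]_m) (rho : R)
  (l : 'I_K.+1 -> 'rV[R]_n -> 'rV[R]_m -> R)
  (hc : transport_cost Z c)
  (hzhat : forall i, Z (zhat i))
  (hrho : 0 < rho)
  (hX : convex_set X)
  (hZc : closed Z) (hZ : convex_set Z)
  (hlx : forall k z, convex_function setT (fun x => l k x z))
  (hlz : forall k x, concave_function setT (l k x))
  (hgrowth : growth_condition X Z c (max_loss l)).

Definition feasible : set (plan R m N K) :=
  [set th | admissible Z th /\ plan_cost c zhat th <= rho].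

Lemma transport_cost_lsc i z a : Z z -> a < c z (zhat i) ->
  \forall z' \near z, Z z' -> a < c z' (zhat i).
Proof.
have [_ lsc _ _] := hc; move=> Zz az.
have ZZ : (Z `*` Z) (z, zhat i) by split => //=.
have [V nV Va] := lsc (z, zhat i) a az.
move: nV; rewrite /nbhs /= -nbhs_subspace_in//.
case=> -[P Q] [/= nP nQ] PQ; apply: filterS nP => z' Pz' Zz'.
have := Va (z', zhat i); rewrite lte_fin; apply.
by apply: (PQ (z', zhat i)); split => //=; exact: nbhs_singleton.
Qed.

Lemma transport_cost_ge0 i z : Z z -> 0 <= c z (zhat i).
Proof. by have [c0 _ _ _] := hc; move=> Zz; exact: c0. Qed.

Lemma feasible_compactness (S : set ('rV[R]_n * R)) :
  (forall q, S q -> X q.1) ->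
  (forall (s : seq ('rV[R]_n * R)) e, (forall q, q \in s -> S q) -> 0 < e ->
    exists th, [/\ admissible Z th, plan_cost c zhat th <= rho + e &
      forall q, q \in s -> q.2 - e <= plan_loss l q.1 th]) ->
  exists2 th, feasible th & forall q, S q -> q.2 <= plan_loss l q.1 th.
Proof.
move=> SX hS.
have [th [adm hcost hth]] := plan_compactness hZc hzhat transport_cost_ge0
  transport_cost_lsc (transport_cost_coercive hgrowth hzhat)
  (fun k x => concave_continuous (hlz k x))
  (loss_dominated_by_cost hgrowth hzhat hlz) SX hS.
by exists th.
Qed.

(** Each sample sends its whole mass to a single piece and atom, so that loss and cost become plain
    averages in which the samples can be chosen independently. *)
Lemma choice_plan_admissible (k : 'I_N.+1 -> 'I_K.+1) (z : 'I_N.+1 -> 'rV[R]_m) :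
  (forall i, Z (z i)) ->
  exists th, [/\ admissible Z th,
    forall x, plan_loss l x th = N.+1%:R^-1 * \sum_i l (k i) x (z i) &
    plan_cost c zhat th = N.+1%:R^-1 * \sum_i c (z i) (zhat i)].
Proof.
move=> Zz; pose w (ik : 'I_N.+1 * 'I_K.+1) : R :=
  if ik.2 == k ik.1 then N.+1%:R^-1 else 0.
have sumw (g : 'I_N.+1 -> 'I_K.+1 -> R) :
    \sum_ik w ik * g ik.1 ik.2 = N.+1%:R^-1 * \sum_i g i (k i).
  rewrite -(pair_bigA _ (fun i j => w (i, j) * g i j))/= mulr_sumr.
  apply: eq_bigr => i _; rewrite (bigD1 (k i))//= /w /= eqxx big1 ?addr0//.
  by move=> j /negbTE ->; rewrite mul0r.
exists (w, fun ik => z ik.1); split.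
- split => /= [ik|i|ik] //; first by rewrite /w; case: ifP.
  rewrite (bigD1 (k i))//= /w /= eqxx big1 ?addr0//.
  by move=> j /negbTE ->.
- by move=> x; exact: (sumw (fun i j => l j x (z i))).
- exact: (sumw (fun i j => c (z i) (zhat i))).
Qed.

(** No sample moves. As [rho] is positive, this plan has slack in the budget and is the Slater point
    of [plan_duality]. *)
Lemma idle_plan : exists th : plan R m N K,
  admissible Z th /\ plan_cost c zhat th = 0.
Proof.
have [th [adm _ cth]] := choice_plan_admissible (fun=> ord0) hzhat.
exists th; split=> //; rewrite cth big1 ?mulr0// => i _.
by have [_ _ c0 _] := hc; exact: c0.
Qed.

Lemma feasible_nonempty : feasible !=set0.
Proof.
by have [th [adm c0]] := idle_plan; exists th; split; rewrite ?c0 ?ltW.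
Qed.

Lemma feasible_loss_bounded x : X x ->
  exists M, forall th, feasible th -> plan_loss l x th <= M.
Proof.
move=> Xx.
have [C C0 hC] := loss_dominated_by_cost hgrowth hzhat hlz Xx ltr01.
exists (C + rho) => th [adm cth]; have [w0 _ Zth] := adm.
apply: (@le_trans _ _ (\sum_ik th.1 ik * (C + c (th.2 ik) (zhat ik.1)))).
  apply: ler_sum => ik _; rewrite ler_wpM2l//.
  by have := hC ik.1 ik.2 _ (Zth ik); rewrite mul1r.
under eq_bigr do rewrite mulrDr.
by rewrite big_split/= -mulr_suml (admissible_sum1 adm) mul1r lerD2l.
Qed.

(** The supremum of the losses at [x] is a single demand, met up to any slack by nearly optimal
    plans; compactness then removes the slack. *)
Lemma best_plan x : X x -> exists2 th, feasible th &
  forall th', feasible th' -> plan_loss l x th' <= plan_loss l x th.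
Proof.
move=> Xx; pose A := [set plan_loss l x th | th in feasible].
have supA : has_sup A.
  split; first by have [th Tth] := feasible_nonempty; exists (plan_loss l x th), th.
  by have [M hM] := feasible_loss_bounded Xx; exists M => _ [th Tth <-]; exact: hM.
have [|s e sS e0|th Tth hth] := @feasible_compactness [set (x, sup A)].
- by move=> q ->.
- have [_ [th [adm cth] <-] h] := sup_adherent e0 supA.
  exists th; split => // [|q /sS ->/=]; last exact: ltW.
  by rewrite (le_trans cth)// lerDl ltW.
exists th => // th' Tth'; apply: le_trans (hth _ erefl).
by apply: ub_le_sup; [case: supA|exists th'].
Qed.

Lemma plan_loss_convex (th : plan R m N K) : admissible Z th ->
  convex_function setT (plan_loss l ^~ th).
Proof.
move=> [w0 _ _] t x y _ _; have t0 : 0 <= t%:num by [].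
have t1 : t%:num <= 1 by [].
have t01 : 0 <= t%:num <= 1 by apply/andP.
apply: (@le_trans _ _ (\sum_ik th.1 ik *
  (t%:num * l ik.2 x (th.2 ik) + (1 - t%:num) * l ik.2 y (th.2 ik)))).
  apply: ler_sum => ik _; rewrite ler_wpM2l//.
  exact: (@convex_functionP _ _ setT (fun x => l ik.2 x (th.2 ik))).
rewrite le_eqVlt; apply/orP; left; apply/eqP.
transitivity (t%:num * plan_loss l x th + (1 - t%:num) * plan_loss l y th) => //.
rewrite /plan_loss !mulr_sumr -big_split/=; apply: eq_bigr => ik _; ring.
Qed.

Lemma feasible_mix (th1 th2 : plan R m N K) (t : R) :
  feasible th1 -> feasible th2 -> 0 <= t <= 1 ->
  exists2 th, feasible th & forall x,
    t * plan_loss l x th1 + (1 - t) * plan_loss l x th2 <= plan_loss l x th.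
Proof.
move=> [a1 c1] [a2 c2] t01; have [_ _ _ hcc] := hc.
have [th [adm lth cth]] := plan_mix hZ (fun i => hcc _ (hzhat i)) hlz a1 a2 t01.
exists th => //; split => //; apply: (le_trans cth); nra.
Qed.

(** By compactness finitely many points of [X] and a slack suffice, and the finite minimax theorem
    reduces these to one weight vector. A plan that is good at the weighted mean of the points is
    good on average, since the loss is convex in [x]. *)
Lemma plan_minimax (V : R) :
  (forall x, X x -> exists2 th, feasible th & V <= plan_loss l x th) ->
  exists2 th, feasible th & forall x, X x -> V <= plan_loss l x th.
Proof.
move=> hV.
have [|s e sS e0|th Tth hth] := @feasible_compactness [set q | X q.1 /\ q.2 = V].
- by move=> q [].
- pose xs (i : 'I_(size s)) := (tnth (in_tuple s) i).1.
  have Xxs i : X (xs i) by have [] := sS _ (mem_tnth i (in_tuple s)).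
  have [| |th [adm cth] hth] := @concavelike_finite_minimax R _ feasible _
      (fun th i => plan_loss l (xs i) th - V) feasible_nonempty _ _ e e0.
  + move=> th1 th2 t T1 T2 t01.
    have [th Tth hth] := feasible_mix T1 T2 t01.
    by exists th => // i; have := hth (xs i); lra.
  + move=> w w0 w1.
    have X_cst : convex_function X (fun=> 0 : R).
      by move=> t x y _ _; rewrite convRE !mulr0 addr0.
    have [Xw _] := jensen hX X_cst w0 Xxs w1.
    have [th Tth hth] := hV _ Xw; exists th => //.
    have cvx : convex_function X (plan_loss l ^~ th).
      by move=> t x y _ _; apply: (plan_loss_convex Tth.1); exact: mem_set.
    have [_ jen] := jensen hX cvx w0 Xxs w1.
    under eq_bigr do rewrite mulrBr.
    by rewrite sumrB -mulr_suml w1 mul1r subr_ge0 (le_trans hth).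
  exists th; split => // [|q qs]; first by rewrite (le_trans cth)// lerDl ltW.
  have [_ ->] := sS _ qs.
  have /tnthP[i ->] : q \in in_tuple s by [].
  by have := hth i; rewrite /xs; lra.
by exists th => // x Xx; exact: (hth (x, V)).
Qed.

Lemma plan_duality x (v : R) : X x ->
  (forall th, feasible th -> plan_loss l x th < v) ->
  exists2 lam, 0 <= lam & forall th, admissible Z th ->
    plan_loss l x th - lam * plan_cost c zhat th <= v - lam * rho.
Proof.
move=> Xx hv; have [_ _ _ hcc] := hc.
pose u (th : plan R m N K) (i : 'I_2) :=
  if i == ord0 then plan_loss l x th - v else rho - plan_cost c zhat th.
have [th0 [adm0 cth0]] := idle_plan.
have [w [w0 w1 hw]] : exists w : 'I_2 -> R, [/\ forall i, 0 <= w i,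
    \sum_i w i = 1 &
    forall th, admissible Z th -> \sum_i w i * u th i < 0].
  apply: contrapT => nw.
  have fan e : 0 < e -> exists2 th, admissible Z th & forall i, - e <= u th i.
    apply: concavelike_finite_minimax.
    - by exists th0.
    - move=> th1 th2 t a1 a2 t01.
      have [th [adm lth cth]] := plan_mix hZ (fun i => hcc _ (hzhat i)) hlz a1 a2 t01.
      exists th => // i; rewrite /u; case: ifP => _; last nra.
      by have := lth x; nra.
    - move=> w w0 w1; apply: contrapT => nth; apply: nw; exists w; split => //.
      move=> th adm; rewrite ltNge; apply/negP => h; apply: nth.
      by exists th.
  have [|s e sS e0|th Tth hth] := @feasible_compactness [set (x, v)].
  - by move=> q ->.
  - have [th adm hth] := fan _ e0; exists th; split => // [|q /sS ->/=].
      by have := hth (lift ord0 ord0); rewrite /u/=; lra.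
    by have := hth ord0; rewrite /u/=; lra.
  by have := hv _ Tth; have := hth _ erefl => /=; lra.
pose a := w ord0; pose b := w (lift ord0 ord0).
have hab th : admissible Z th ->
    a * (plan_loss l x th - v) + b * (rho - plan_cost c zhat th) < 0.
  by move/hw; rewrite big_ord_recl big_ord1.
have a0 : 0 <= a by exact: w0.
have b0 : 0 <= b by exact: w0.
(* With no weight on the loss, the unspent budget of the idle plan would give a nonnegative
   average. *)
have ap : 0 < a.
  rewrite lt_neqAle a0 andbT eq_sym; apply/eqP => aE.
  have := hab _ adm0; rewrite aE mul0r add0r cth0 subr0 ltNge.
  by rewrite mulr_ge0// ltW.
exists (b / a) => [|th adm]; first by rewrite divr_ge0.
rewrite -subr_ge0 -(pmulr_rge0 _ ap).
have -> : a * (v - b / a * rho - (plan_loss l x th - b / a * plan_cost c zhat th))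
    = - (a * (plan_loss l x th - v) + b * (rho - plan_cost c zhat th)).
  by field; rewrite gt_eqF.
by rewrite oppr_ge0 ltW// hab.
Qed.

(** The penalized bound decouples over the samples: [s] is the supremum of the penalized loss over
    pieces and atoms, and nearly optimal choices for all samples together form one plan. *)
Lemma dual_certificate x (v : R) : X x ->
  (forall th, feasible th -> plan_loss l x th < v) ->
  exists lam (s : 'rV[R]_m -> R), [/\ 0 <= lam,
    forall i z, Z z -> max_loss l x z <= lam * c z (zhat i) + s (zhat i) &
    N.+1%:R^-1 * \sum_i s (zhat i) <= v - lam * rho].
Proof.
move=> Xx hv; have [lam lam0 hlam] := plan_duality Xx hv; exists lam.
(* [A] depends on the point and not on the index, so that coinciding samples share one value of
   [s]. *)
pose A p := [set l kz.1 x kz.2 - lam * c kz.2 p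
            | kz in [set kz : 'I_K.+1 * 'rV[R]_m | Z kz.2]].
have N0 : 0 < N.+1%:R^-1 :> R by rewrite invr_gt0 ltr0n.
have hA (kz : 'I_N.+1 -> 'I_K.+1 * 'rV[R]_m) : (forall i, Z (kz i).2) ->
    N.+1%:R^-1 * \sum_i (l (kz i).1 x (kz i).2 - lam * c (kz i).2 (zhat i))
      <= v - lam * rho.
  move=> Zkz.
  have [th [adm lth cth]] := choice_plan_admissible (fun i => (kz i).1) Zkz.
  by have := hlam _ adm; rewrite lth cth sumrB -mulr_sumr mulrBr mulrCA.
have supA i : has_sup (A (zhat i)).
  split.
    exists (l ord0 x (zhat i) - lam * c (zhat i) (zhat i)).
    by exists (ord0, zhat i) => //=; exact: hzhat.
  (* With all other samples left in place, the bound on the sum bounds the [i]-th term alone. *)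
  pose g j := l ord0 x (zhat j) - lam * c (zhat j) (zhat j).
  exists (N.+1%:R * (v - lam * rho) - \sum_(j | j != i) g j).
  move=> _ [kz Zkz <-].
  have := hA (fun j => if j == i then kz else (ord0, zhat j)).
  rewrite ler_pdivrMl ?ltr0n// (bigD1 i)//= eqxx.
  rewrite (eq_bigr g) => [h|j /negbTE -> //]; rewrite lerBrDr; apply: h => j.
  by case: ifP => // _; exact: hzhat.
exists (fun p => sup (A p)); split => // [i z Zz|].
  have [k ->] := max_loss_attained l x z; rewrite -lerBlDl.
  by apply: ub_le_sup; [case: (supA i)|exists (k, z)].
apply/ler_addgt0Pr => e e0.
have /choice[kz kzP] : forall i, exists kz : 'I_K.+1 * 'rV[R]_m,
    Z kz.2 /\ sup (A (zhat i)) - e <= l kz.1 x kz.2 - lam * c kz.2 (zhat i).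
  move=> i; have [_ [kz Zkz <-] h] := sup_adherent e0 (supA i).
  by exists kz; split => //; exact: ltW.
rewrite -lerBlDr; apply: le_trans (hA kz (fun i => (kzP i).1)).
have -> : N.+1%:R^-1 * \sum_i sup (A (zhat i)) - e
    = N.+1%:R^-1 * \sum_i (sup (A (zhat i)) - e).
  rewrite sumrB sumr_const card_ord mulrBr -[e *+ _]mulr_natl mulrA.
  by rewrite mulVf ?mul1r// pnatr_eq0.
by rewrite ler_pM2l//; apply: ler_sum => i _; exact: (kzP i).2.
Qed.

End plan_game.

Import HBNNSimple.

(** * Integrals, marginals and discrete measures *)

Section integration.
Context (d : measure_display) (T : measurableType d) (R : realType).
Local Open Scope ereal_scope.

(** The integral of a nonnegative function is a supremum over the simple functions below it, which
    compares directly. The cost is handled in this way, its measurability for the product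
    sigma-algebra never being established. *)
Lemma ge0_le_integral_patch (mu : {measure set T -> \bar R}) (D E : set T)
    (f g : T -> \bar R) :
  (forall x, D x -> 0 <= f x) -> (forall x, E x -> 0 <= g x) ->
  (forall x, (f \_ D) x <= (g \_ E) x) ->
  \int[mu]_(x in D) f x <= \int[mu]_(x in E) g x.
Proof.
move=> f0 g0 fg; rewrite !ge0_integralE//; apply: le_ereal_sup => _ [h hf <-].
by exists h => // x; exact: le_trans (hf x) (fg x).
Qed.

Lemma le_integral_measurable (mu : {measure set T -> \bar R}) (D : set T)
    (f g : T -> \bar R) :
  measurable D -> measurable_fun D f -> measurable_fun D g ->
  (forall x, D x -> f x <= g x) ->
  \int[mu]_(x in D) f x <= \int[mu]_(x in D) g x.
Proof.
move=> mD mf mg fg.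
have fg' : {in D, forall x, f x <= g x} by move=> x /set_mem; exact: fg.
rewrite integralE [leRHS]integralE leeB//.
- apply: ge0_le_integral => //; [exact: measurable_funepos|
    exact: measurable_funepos|by move=> x /mem_set; exact: funepos_le].
- apply: ge0_le_integral => //; [exact: measurable_funeneg|
    exact: measurable_funeneg|by move=> x /mem_set; exact: funeneg_le].
Qed.

Lemma integral_full_set (P : probability T R) (E : set T) (f : T -> \bar R) :
  measurable E -> P E = 1 -> measurable_fun setT f ->
  \int[P]_x f x = \int[P]_(x in E) f x.
Proof.
move=> mE PE mf.
have nE : P (~` E) = 0 by rewrite probability_setC// PE subee.
have eq0 g : measurable_fun setT g -> (forall x, 0 <= g x) ->
    \int[P]_x g x = \int[P]_(x in E) g x.
  move=> mg g0.
  rewrite (@ge0_negligible_integral _ _ _ _ _ (~` E))//; last exact: measurableC.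
  by rewrite setTD setCK.
rewrite integralE [RHS]integralE !eq0//; [exact: measurable_funeneg|
  exact: measurable_funepos].
Qed.

Lemma integral_marginal (d' : measure_display) (T' : measurableType d')
    (P : probability T R) (P' : probability T' R) (phi : T -> T')
    (f : T' -> \bar R) :
  measurable_fun setT phi ->
  (forall A, measurable A -> P (phi @^-1` A) = P' A) ->
  measurable_fun setT f ->
  \int[P']_y f y = \int[P]_x f (phi x).
Proof.
move=> mphi PP' mf.
have eq0 g : measurable_fun setT g -> (forall x, 0 <= g x) ->
    \int[P']_y g y = \int[P]_x g (phi x).
  move=> mg g0.
  rewrite -[RHS](@ge0_integral_pushforward _ _ _ _ R phi mphi P setT g)//.
  by apply: eq_measure_integral => A mA _; apply/esym; exact: PP'.
rewrite integralE eq0//; last exact: measurable_funepos.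
rewrite eq0//; last exact: measurable_funeneg.
rewrite [RHS]integralE.
by congr (_ - _); apply: eq_integral => x _; rewrite ?funeposE ?funenegE.
Qed.

Context (I : finType) (w : I -> R) (a : I -> T).

Lemma discrete_probability :
  (forall i, (0 <= w i)%R) -> (\sum_i w i = 1)%R ->
  exists P : probability T R,
    forall A, P A = (\sum_i w i * (a i \in A)%:R)%R%:E.
Proof.
move=> w0 w1.
have [i0 _] : exists i0 : I, True.
  apply: contrapT => /forallNP h; have : (\sum_i w i != 0)%R.
    by rewrite w1 oner_neq0.
  move=> /eqP; apply.
  by apply: big1 => i; case: (h i).
(* [msum] sums over natural numbers, hence the enumeration of [I] with default [i0]. *)
pose ev := nth i0 (index_enum I).
pose mu : {measure set T -> \bar R} :=
  msum (fun j => mscale (NngNum (w0 (ev j))) \d_(a (ev j))) (size (index_enum I)).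
have muE A : mu A = (\sum_i w i * (a i \in A)%:R)%R%:E.
  rewrite -sumEFin (big_nth i0) big_mkord; apply: eq_bigr => j _.
  by rewrite /= /mscale/= diracE -EFinM.
have mu1 : mu setT = 1.
  rewrite muE; congr EFin; rewrite -[RHS]w1; apply: eq_bigr => i _.
  by rewrite mem_set// mulr1.
by exists (HB.pack_for (probability T R) (Measure.sort mu)
  (Measure_isProbability.Build _ _ _ mu mu1)).
Qed.

Context (w0 : forall i, (0 <= w i)%R) (P : probability T R)
  (PE : forall A, measurable A -> P A = (\sum_i w i * (a i \in A)%:R)%R%:E).

Let ge0_integral_discrete (f : T -> \bar R) : measurable_fun setT f ->
  (forall x, 0 <= f x) -> \int[P]_x f x = \sum_i (w i)%:E * f (a i).
Proof.
move=> mf f0.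
have [[i0 _]|empty] := pselect (exists i0 : I, True); last first.
  have : P setT = 0.
    by rewrite PE// big1// => i; case: empty; exists i.
  by rewrite probability_setT => /eqP; rewrite onee_eq0.
pose ev := nth i0 (index_enum I).
pose mu : {measure set T -> \bar R} :=
  msum (fun j => mscale (NngNum (w0 (ev j))) \d_(a (ev j))) (size (index_enum I)).
rewrite (@eq_measure_integral _ _ _ setT mu) => [|A mA _]; last first.
  apply: (eq_trans (PE mA)); rewrite -sumEFin (big_nth i0) big_mkord.
  apply: eq_bigr => j _.
  by rewrite /= /mscale/= diracE -EFinM.
rewrite ge0_integral_measure_sum// [RHS](big_nth i0) big_mkord.
apply: eq_bigr => j _; rewrite ge0_integral_mscale//=.
by rewrite integral_dirac// diracT mul1e.
Qed.

Lemma integral_discrete (f : T -> R) : measurable_fun setT f ->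
  \int[P]_x (f x)%:E = (\sum_i w i * f (a i))%R%:E.
Proof.
move=> mf; have mf' : measurable_fun setT (EFin \o f) by exact/measurable_EFinP.
rewrite integralE !ge0_integral_discrete//; [|exact: measurable_funeneg|
  exact: measurable_funepos].
under eq_bigr do rewrite funeposE -[0]/(0%R%:E) -EFin_max -EFinM.
under [X in _ - X]eq_bigr do rewrite funenegE -[0]/(0%R%:E) -EFinN -EFin_max -EFinM.
rewrite !sumEFin -EFinB -sumrB; congr EFin; apply: eq_bigr => i _.
rewrite -mulrBr; congr (_ * _)%R; rewrite !maxEle.
by case: ifP => h1; case: ifP => h2; lra.
Qed.

(* [g] need not be measurable: its integral is then a lower integral. *)
Lemma ge0_le_integral_discrete (D : set T) (g : T -> R) :
  (forall x, D x -> (0 <= g x)%R) -> (forall i, D (a i)) ->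
  \int[P]_(x in D) (g x)%:E <= (\sum_i w i * g (a i))%R%:E.
Proof.
move=> g0 Da; rewrite ge0_integralE; last by move=> x Dx; rewrite lee_fin g0.
apply: ge_ereal_sup => _ [h hg <-]; rewrite -integralT_nnsfun.
rewrite integral_discrete; last exact: measurable_funP.
rewrite lee_fin; apply: ler_sum => i _; rewrite ler_wpM2l//.
by have := hg (a i); rewrite patchE mem_set// lee_fin.
Qed.

End integration.

(** * Borel measurability of the loss *)

Section borel.
Context (R : realType) (m : nat).

Lemma closed_borel (A : set 'rV[R]_m) :
  closed A -> measurable (A : set (borelRV R m)).
Proof.
move=> cA; rewrite -(setCK A); apply: measurableC.
by apply: sub_sigma_algebra; exact: closed_openC.
Qed.

Lemma continuous_borel (f : 'rV[R]_m -> R) :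
  continuous f -> measurable_fun setT (f : borelRV R m -> R).
Proof.
move=> cf; apply: (measurability _ (RGenOInfty.measurableE R)).
move=> _ [_ [a ->] <-]; rewrite setTI; apply: sub_sigma_algebra.
rewrite /=; apply: open_comp => [x _|]; first exact: cf.
exact: interval_open.
Qed.

Lemma measurable_max_loss (n K : nat)
    (l : 'I_K.+1 -> 'rV[R]_n -> 'rV[R]_m -> R) (x : 'rV[R]_n) :
  (forall k, continuous (l k x)) ->
  measurable_fun setT (max_loss l x : borelRV R m -> R).
Proof.
move=> cl; rewrite /max_loss; elim: (index_enum _) => [|k r IH].
  by under eq_fun do rewrite big_nil; exact: continuous_borel.
under eq_fun do rewrite big_cons.
by apply: measurable_maxr => //; exact: continuous_borel.
Qed.

Lemma expected_lossE (n : nat) (loss : 'rV[R]_n -> 'rV[R]_m -> R)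
    (x : 'rV[R]_n) (Q : probability (borelRV R m) R) :
  expected_loss loss x Q = (\int[Q]_z (loss x z)%:E)%E.
Proof. by rewrite /expected_loss expectation.unlock. Qed.

End borel.

(** * Comparison of plans with the measures of the ambiguity set *)

Section plans_and_measures.
Context (R : realType) (n m N K : nat)
  (X : set 'rV[R]_n) (Z : set 'rV[R]_m)
  (c : 'rV[R]_m -> 'rV[R]_m -> R)
  (zhat : 'I_N.+1 -> 'rV[R]_m) (rho : R)
  (l : 'I_K.+1 -> 'rV[R]_n -> 'rV[R]_m -> R)
  (hc : transport_cost Z c)
  (hzhat : forall i, Z (zhat i))
  (hrho : 0 < rho)
  (hZc : closed Z) (hZ : convex_set Z)
  (hlz : forall k x, concave_function setT (l k x))
  (hgrowth : growth_condition X Z c (max_loss l)).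

Let mZ : measurable (Z : set (borelRV R m)) := closed_borel hZc.

Let mloss x : measurable_fun setT (max_loss l x : borelRV R m -> R) :=
  measurable_max_loss (fun k => concave_continuous (hlz k x)).

Lemma empiricalE (A : set (borelRV R m)) :
  empirical zhat A = (\sum_i N.+1%:R^-1 * (zhat i \in A)%:R)%R%:E.
Proof.
rewrite /empirical; under eq_bigr do rewrite diracE.
by rewrite sumEFin -EFinM mulr_sumr.
Qed.

Lemma integral_empirical (f : borelRV R m -> R) : measurable_fun setT f ->
  (\int[empirical zhat]_z (f z)%:E)%E = (N.+1%:R^-1 * \sum_i f (zhat i))%:E.
Proof.
move=> mf; have N0 (i : 'I_N.+1) : 0 <= N.+1%:R^-1 :> R by [].
rewrite (@integral_discrete _ _ R _ _ (zhat : 'I_N.+1 -> borelRV R m) N0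
  (empirical zhat) (fun A _ => empiricalE A) f mf).
by rewrite mulr_sumr.
Qed.

(** [Q] is the law of the atoms; the same masses on the pairs (atom, sample) couple it with the
    empirical measure at no more than the cost of the plan. The loss can only grow because each
    piece lies below the maximum. *)
Lemma plan_realized th : feasible Z c zhat rho th ->
  exists2 Q, ambiguity Z c zhat rho Q & forall x,
    ((plan_loss l x th)%:E <= expected_loss (max_loss l) x Q)%E.
Proof.
move=> [adm cth]; have [w0 s1 Zth] := adm.
have w1 := admissible_sum1 adm.
have [Q QE] := @discrete_probability _ (borelRV R m) R _ _ th.2 w0 w1.
have [g gE] := @discrete_probability _ (borelRV R m * borelRV R m)%type R _ _
  (fun ik => (th.2 ik, zhat ik.1)) w0 w1.
exists Q; last first.
  move=> x; rewrite expected_lossE (integral_discrete w0 (fun A _ => QE A))//.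
  rewrite lee_fin; apply: ler_sum => ik _; rewrite ler_wpM2l//.
  exact: le_max_loss.
split.
  rewrite QE; congr EFin; rewrite -[RHS]w1; apply: eq_bigr => ik _.
  by rewrite mem_set// mulr1.
apply: ereal_inf_le; exists (\int[g]_(w in Z `*` Z) (c w.1 w.2)%:E)%E.
  exists g => // A mA; split.
    by rewrite gE QE; congr EFin; apply: eq_bigr => ik _; rewrite !inE.
  rewrite gE; apply/esym; apply: (eq_trans (empiricalE A)); apply/esym.
  congr EFin.
  transitivity (\sum_ik th.1 (ik.1, ik.2) * (zhat ik.1 \in A)%:R).
    by apply: eq_bigr => -[i k] _.
  rewrite -(pair_bigA _ (fun i k => th.1 (i, k) * (zhat i \in A)%:R))/=.
  by apply: eq_bigr => i _; rewrite -mulr_suml s1.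
have [c0 _ _ _] := hc.
apply: (le_trans (ge0_le_integral_discrete w0 (fun A _ => gE A) _ _)).
- by move=> w [Z1 Z2]; exact: c0.
- by move=> ik; split => //=.
by rewrite lee_fin.
Qed.

(* Weak duality: against a coupling of [Q] with the empirical measure, the loss
   is dominated by [lam * c + s]. *)
Lemma expected_loss_le x (v : R) Q : X x ->
  (forall th, feasible Z c zhat rho th -> plan_loss l x th < v) ->
  ambiguity Z c zhat rho Q ->
  (expected_loss (max_loss l) x Q <= v%:E)%E.
Proof.
move=> Xx hv [QZ otQ].
have [lam [s [lam0 hs sv]]] :=
  dual_certificate hc hzhat hrho hZc hZ hlz hgrowth Xx hv.
(* Removing duplicates leaves exactly one indicator of [s'] nonzero at each sample. *)
pose pts : seq 'rV[R]_m := undup [seq zhat i | i <- index_enum 'I_N.+1].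
have zpts i : zhat i \in pts by rewrite mem_undup map_f// mem_index_enum.
pose E0 : set (borelRV R m) := [set z | z \in pts].
have cE0 : closed (E0 : set 'rV[R]_m).
  apply: (proj1 (@accessible_finite_set_closed _)).
    by apply: hausdorff_accessible; exact: norm_hausdorff.
  exact: finite_seq.
have mE0 : measurable E0 by exact: closed_borel.
have m1 p : measurable ([set p] : set (borelRV R m)).
  by apply: closed_borel; apply: accessible_closed_set1;
    apply: hausdorff_accessible; exact: norm_hausdorff.
(* A measurable stand-in for [s], which matters only at the samples. *)
pose s' : borelRV R m -> R := fun z => \sum_(p <- pts) s p * \1_[set p] z.
have ms' : measurable_fun setT s'.
  apply: measurable_sum => p; apply: measurable_funM; first exact: measurable_cst.
  exact: measurable_indic.
have s'E i : s' (zhat i) = s (zhat i).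
  rewrite /s' (bigD1_seq (zhat i)) ?undup_uniq//= indicE mem_set// mulr1.
  rewrite big1 ?addr0// => p pi; rewrite indicE memNset ?mulr0//=.
  by apply/eqP; rewrite eq_sym.
rewrite expected_lossE; apply/lee_addgt0Pr => e e0.
have l1 : 0 < lam + 1 by lra.
(* [OT] is an infimum, so the coupling is optimal only up to [e']; this choice gives
   [lam * e' <= e]. *)
pose e' := e / (lam + 1); have e'0 : 0 < e' by rewrite divr_gt0.
have : (OT Z c Q (empirical zhat) < (rho + e')%:E)%E.
  by apply: (le_lt_trans otQ); rewrite lte_fin ltrDl.
move=> /ereal_inf_lt[_ [g gQ <-] gc].
pose E : set (borelRV R m * borelRV R m) := Z `*` E0.
have mE : measurable E by exact: measurableX.
have gE : g E = 1%E.
  have gZ : g (fst @^-1` (~` (Z : set (borelRV R m)))) = 0%E.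
    have [-> _] := gQ _ (measurableC mZ).
    by rewrite probability_setC// QZ subee.
  have gE0 : g (snd @^-1` (~` E0)) = 0%E.
    have [_ ->] := gQ _ (measurableC mE0).
    apply: (eq_trans (empiricalE _)); rewrite big1// => i _.
    by rewrite memNset ?mulr0//= /E0 /= => /(_ (zpts i)).
  have mf1 : measurable (fst @^-1` (~` Z) : set (borelRV R m * borelRV R m)).
    rewrite -[X in measurable X]setTI.
    by apply: measurable_fst => //; exact: measurableC.
  have mf2 : measurable (snd @^-1` (~` E0) : set (borelRV R m * borelRV R m)).
    rewrite -[X in measurable X]setTI.
    by apply: measurable_snd => //; exact: measurableC.
  have : g (~` E) = 0%E.
    apply/eqP; rewrite eq_le measure_ge0 andbT.
    apply: (@le_trans _ _ (g (fst @^-1` (~` Z) `|` snd @^-1` (~` E0)))).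
      apply: le_measure; rewrite ?inE//; [exact: measurableC|exact: measurableU|].
      by move=> w /not_andP[]; [left|right].
    apply: (le_trans (measureU2 _ _ _)) => //.
    have : (g (fst @^-1` (~` Z)) + g (snd @^-1` (~` E0)) <= 0)%E.
      by rewrite gZ gE0 adde0.
    exact.
  rewrite probability_setC// => h.
  have := probability_setC g (measurableC mE); rewrite setCK => ->.
  by rewrite probability_setC// h sube0.
have mf : measurable_fun setT
    (fun w : borelRV R m * borelRV R m => (max_loss l x w.1)%:E).
  apply/measurable_EFinP.
  by apply: (measurableT_comp (mloss x)); exact: measurable_fst.
have mg : measurable_fun setT (fun w : borelRV R m * borelRV R m => s' w.2).
  by apply: (measurableT_comp ms'); exact: measurable_snd.
rewrite (@integral_marginal _ _ R _ _ g Q fst (fun z => (max_loss l x z)%:E));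
  [|exact: measurable_fst|by move=> A mA; have [] := gQ A mA|
    by apply/measurable_EFinP; exact: mloss].
rewrite (integral_full_set mE gE mf).
(* The positive part is nonnegative and measurable, and on [E] it is still at most [lam * c]; this
   permits the comparison with the cost integral. *)
pose h (w : borelRV R m * borelRV R m) : R :=
  Num.max (max_loss l x w.1 - s' w.2) 0.
have h0 w : 0 <= h w by rewrite le_max lexx orbT.
have mh : measurable_fun setT h.
  apply: measurable_maxr; last exact: measurable_cst.
  by apply: measurable_funB => //; exact/measurable_EFinP.
have hle w : E w -> h w <= lam * c w.1 w.2.
  move=> [/= Z1]; rewrite /E0 /= mem_undup => /mapP[i _ w2].
  rewrite ge_max; have := hs i _ Z1; rewrite w2 s'E => h1; apply/andP; split.
    by lra.
  by rewrite mulr_ge0// (transport_cost_ge0 hc hzhat).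
have c0 w : (Z `*` Z) w -> (0 <= (c w.1 w.2)%:E)%E.
  by have [c0 _ _ _] := hc; move=> [Z1 Z2]; rewrite lee_fin c0.
have EZZ : E `<=` Z `*` Z.
  move=> w [/= Z1]; rewrite /E0 /= mem_undup => /mapP[i _ w2].
  by split => //=; rewrite w2.
have inth : (\int[g]_(w in E) (h w)%:E <= (lam * (rho + e'))%:E)%E.
  (* The comparison with the cost divides by [lam]; for [lam = 0] the function [h] vanishes on
     [E]. *)
  have [lamE|lamN] := eqVneq lam 0.
    rewrite lamE mul0r (@eq_integral _ _ _ _ _ (cst 0%E)) ?integral0// => w.
    move=> /set_mem/hle; rewrite lamE mul0r => hw.
    by congr EFin; apply/eqP; rewrite eq_le hw h0.
  have lamp : 0 < lam by rewrite lt_neqAle eq_sym lamN.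
  have -> : (\int[g]_(w in E) (h w)%:E =
      \int[g]_(w in E) (lam%:E * (lam^-1 * h w)%:E))%E.
    by apply: eq_integral => w _; rewrite -EFinM mulVKf.
  have lh0 w : E w -> (0 <= (lam^-1 * h w)%:E)%E.
    by move=> _; rewrite lee_fin mulr_ge0// invr_ge0 ltW.
  have mlh : measurable_fun E (fun w => (lam^-1 * h w)%:E).
    apply/measurable_EFinP; apply: measurable_funTS.
    by apply: measurable_funM => //; exact: measurable_cst.
  rewrite (ge0_integralZl _ mE mlh lh0) ?lee_fin//.
  rewrite EFinM lee_pmul2l// ?lte_fin//; apply: le_trans (ltW gc).
  apply: ge0_le_integral_patch => // w.
  rewrite !patchE; case: ifPn => [/set_mem Ew|_].
    by rewrite mem_set; [rewrite lee_fin ler_pdivrMl// hle|exact: EZZ].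
  by case: ifPn => // /set_mem/c0.
have ints' : (\int[g]_w (s' w.2)%:E = (N.+1%:R^-1 * \sum_i s (zhat i))%:E)%E.
  rewrite -(@integral_marginal _ _ R _ _ g (empirical zhat) snd
      (fun z => (s' z)%:E));
    [|exact: measurable_snd|by move=> A mA; have [] := gQ A mA|
      exact/measurable_EFinP].
  rewrite integral_empirical//; congr (_ * _)%:E.
  by apply: eq_bigr => i _; rewrite s'E.
have iabs : g.-integrable setT (fun w => (s' w.2)%:E).
  apply/integrableP; split; first exact/measurable_EFinP.
  rewrite -(@integral_marginal _ _ R _ _ g (empirical zhat) snd
      (fun z => `|(s' z)%:E|%E));
    [|exact: measurable_snd|by move=> A mA; have [] := gQ A mA|
      by apply: measurableT_comp => //; exact/measurable_EFinP].
  rewrite (integral_empirical (f := fun z => `|s' z|)) ?ltry//.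
  exact: measurableT_comp.
have inthI : g.-integrable E (fun w => (h w)%:E).
  apply/integrableP; split.
    by apply/measurable_EFinP; exact: measurable_funTS.
  under eq_integral do rewrite gee0_abs ?lee_fin//.
  by apply: (le_lt_trans inth); rewrite ltry.
apply: (@le_trans _ _ (\int[g]_(w in E) ((h w)%:E + (s' w.2)%:E))%E).
  apply: le_integral_measurable => //; first exact: measurable_funTS.
    by apply: emeasurable_funD; apply/measurable_EFinP; exact: measurable_funTS.
  move=> w _; rewrite -EFinD lee_fin -lerBlDr.
  by rewrite /h le_max lexx.
rewrite integralD//; last exact: (integrableS _ _ _ iabs).
have mg' : measurable_fun setT
    (fun w : borelRV R m * borelRV R m => (s' w.2)%:E).
  exact/measurable_EFinP.
rewrite -[X in (_ + X <= _)%E](integral_full_set mE gE mg') ints'.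
apply: (le_trans (leeD inth (lexx _))).
rewrite -!EFinD lee_fin.
have le' : lam * e' <= e by rewrite /e' mulrCA ger_pMr// ler_pdivrMr//; lra.
have := lerD sv le'; rewrite mulrDr.
by move: (lam * rho) (lam * e') (N.+1%:R^-1 * _) => a b q; lra.
Qed.

End plans_and_measures.

(** * Saddle points from a common guaranteed value *)

Section saddle_value.
Context (R : realType) (S T : Type).
Local Open Scope ereal_scope.

(** [xs] keeps the payoff at most [V] and [qs] keeps it at least [V], which squeezes both values,
    and the payoff at [(xs, qs)], to [V]. *)
Lemma saddle_value (X : set S) (P : set T) (f : S -> T -> \bar R) xs qs (V : R) :
  X xs -> P qs -> (forall q, P q -> f xs q <= V%:E) ->
  (forall x, X x -> V%:E <= f x qs) ->
  (forall x, X x -> exists q, is_max_on P (f x) q) ->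
  [/\ primal_value X P f \is a fin_num, dual_value X P f \is a fin_num,
      exists xs qs, saddle_point X P f xs qs & minmax_eq_maxmin X P f].
Proof.
move=> Xxs Pqs up lo attained.
have le_sup x : X x -> V%:E <= sup_over P f x.
  by move=> Xx; apply: (le_trans (lo x Xx)); apply: ereal_sup_ubound; exists qs.
have inf_le q : P q -> inf_over X f q <= V%:E.
  by move=> Pq; apply: le_trans (up q Pq); apply: ereal_inf_lbound; exists xs.
have sup_xs : sup_over P f xs <= V%:E.
  by apply: ge_ereal_sup => _ [q Pq <-]; exact: up.
have inf_qs : V%:E <= inf_over X f qs.
  by apply: le_ereal_inf_tmp => _ [x Xx <-]; exact: lo.
have primalE : primal_value X P f = V%:E.
  apply/eqP; rewrite eq_le; apply/andP; split.
    by apply: le_trans sup_xs; apply: ereal_inf_lbound; exists xs.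
  by apply: le_ereal_inf_tmp => _ [x Xx <-]; exact: le_sup.
have dualE : dual_value X P f = V%:E.
  apply/eqP; rewrite eq_le; apply/andP; split.
    by apply: ge_ereal_sup => _ [q Pq <-]; exact: inf_le.
  by apply: (le_trans inf_qs); apply: ereal_sup_ubound; exists qs.
split; [by rewrite primalE|by rewrite dualE| |].
  exists xs, qs; split => // x q Xx Pq; split.
    exact: le_trans (up q Pq) (lo xs Xxs).
  exact: le_trans (up qs Pqs) (lo x Xx).
split => //; first by rewrite primalE dualE.
- by exists xs; split => // x Xx; exact: le_trans sup_xs (le_sup x Xx).
- exists qs; split.
    by split => // q Pq; exact: le_trans (inf_le q Pq) inf_qs.
  exists xs; split => // x Xx; exact: le_trans (up qs Pqs) (lo x Xx).
Qed.

End saddle_value.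

(** * Construction of the saddle point *)

Theorem lemma1 (R : realType) (n m N K : nat)
  (X : set 'rV[R]_n) (Z : set 'rV[R]_m)
  (c : 'rV[R]_m -> 'rV[R]_m -> R)
  (zhat : 'I_N.+1 -> 'rV[R]_m) (rho : R)
  (l : 'I_K.+1 -> 'rV[R]_n -> 'rV[R]_m -> R)
  (hc : transport_cost Z c)
  (hzhat : forall i, Z (zhat i))
  (hrho : 0 < rho)
  (hX0 : X !=set0) (hX : convex_set X)
  (hQ0 : exists (Q0 : probability (borelRV R m) R) (x0 : 'rV[R]_n),
    [/\ ambiguity Z c zhat rho Q0, X x0,
        inf_compact_on X (expected_loss (max_loss l) ^~ Q0)
      & (-oo < expected_loss (max_loss l) x0 Q0)%E])
  (hZ0 : Z !=set0) (hZc : closed Z) (hZ : convex_set Z)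
  (hK : (2 <= K.+1)%N)
  (hlx : forall k z, convex_function setT (fun x => l k x z))
  (hlz : forall k x, concave_function setT (l k x))
  (hgrowth : growth_condition X Z c (max_loss l)) :
  let P := ambiguity Z c zhat rho in
  let f := expected_loss (max_loss l) in
  [/\ primal_value X P f \is a fin_num,
      dual_value X P f \is a fin_num,
      exists xs Qs, saddle_point X P f xs Qs
    & minmax_eq_maxmin X P f].
Proof.
have [x1 Xx1] := hX0; have [Q0 [_ [PQ0 _ icQ0 _]]] := hQ0.
move=> P f.
have /choice[bst bstP] : forall x, exists th, X x ->
    feasible Z c zhat rho th /\ forall th', feasible Z c zhat rho th' ->
      plan_loss l x th' <= plan_loss l x th.
  move=> x; have [Xx|nX] := pselect (X x).
    have [th Tth hth] := best_plan hc hzhat hrho hZc hlz hgrowth Xx.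
    by exists th.
  by exists (fun=> 0, fun=> 0).
pose Phi x := plan_loss l x (bst x).
have fPhi x Q : X x -> P Q -> (f x Q <= (Phi x)%:E)%E.
  (* Weak duality asks for a level strictly above the loss of every feasible plan, hence the slack
     [e]. *)
  move=> Xx PQ; apply/lee_addgt0Pr => e e0; rewrite -EFinD.
  apply: (expected_loss_le hc hzhat hrho hZc hZ hlz hgrowth Xx) => // th Tth.
  by rewrite (le_lt_trans ((bstP x Xx).2 _ Tth))// ltrDl.
(* This level makes [A] a compact sublevel set that contains [x1], by [fPhi]. *)
pose A := [set x | X x /\ (f x Q0 <= (Phi x1)%:E)%E].
have A1 : A x1 by split => //; exact: fPhi.
(* The sublevel sets of [Phi] in the compact set [A] form a filter base, and
   [Phi] is a supremum of continuous functions, so it attains its minimum at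
   any cluster point. *)
have [xs [[Xxs _] clxs]] : A `&` cluster (filter_from A
    (fun x => [set x' | A x' /\ Phi x' <= Phi x])) !=set0.
  apply: icQ0; last by exists x1 => // x [].
  apply: filter_from_proper; last by move=> x Ax; exists x.
  apply: filter_from_filter; first by exists x1.
  move=> x y Ax Ay; have [xy|/ltW yx] := leP (Phi x) (Phi y).
    by exists x => // z [Az zx]; split; split => //; exact: le_trans zx xy.
  by exists y => // z [Az zy]; split; split => //; exact: le_trans zy yx.
have minA x : A x -> Phi xs <= Phi x.
  move=> Ax; have [[adm _] _] := bstP xs Xxs.
  (* The loss at the fixed plan [bst xs] is continuous, lies below [Phi] on [X] and equals it at
     [xs]; the bound by [Phi x] thus passes to the cluster point. *)
  have : closed [set y | plan_loss l y (bst xs) <= Phi x].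
    rewrite (_ : [set y | _] = (plan_loss l ^~ (bst xs)) @^-1` [set r | r <= Phi x])//.
    apply: preimage_closed; last exact: closed_le.
    by move=> y _; apply: convex_continuous; exact: (plan_loss_convex hlx adm).
  apply => B nB.
  have [y [[[Xy _] yx] By]] := clxs _ B (ex_intro2 _ _ x Ax (fun _ h => h)) nB.
  exists y; split => //=; apply: le_trans yx.
  by apply: (bstP y Xy).2; exact: (bstP xs Xxs).1.
have minX x : X x -> Phi xs <= Phi x.
  (* Outside [A], [Phi x] is at least [f x Q0], which exceeds [Phi x1], and [x1] lies in [A]. *)
  move=> Xx; have [fx|] := leP (f x Q0) (Phi x1)%:E; first by apply: minA.
  move=> /lt_le_trans/(_ (fPhi _ _ Xx PQ0)); rewrite lte_fin => /ltW.
  exact/le_trans/minA.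
have [ths Tths hths] : exists2 th, feasible Z c zhat rho th &
    forall x, X x -> Phi xs <= plan_loss l x th.
  apply: (plan_minimax hc hzhat hrho hX hZc hZ hlx hlz hgrowth) => x Xx.
  by exists (bst x); [exact: (bstP x Xx).1|exact: minX].
have [Qs PQs fQs] := plan_realized hc hzhat hlz Tths.
apply: (@saddle_value _ _ _ X P f xs Qs (Phi xs)) => //.
- by move=> q; exact: fPhi.
- by move=> x Xx; apply: le_trans (fQs x); rewrite lee_fin hths.
- move=> x Xx; have [Q PQ fQ] := plan_realized hc hzhat hlz (bstP x Xx).1.
  by exists Q; split => // Q' PQ'; exact: le_trans (fPhi x Q' Xx PQ') (fQ x).
Qed.
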